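(* Let $\alpha\ge 1$, $\delta>0$, $0<\eta<1$, $\nu=\frac{1-\alpha}{2}$. Assume that: (i) there exist $u_0,v_0\in C^2[0,1]$ with $v_0\le u_0$ on $[0,1]$, where $$-(x^{\alpha}u_0'(x))'\ge x^{\alpha}f(x,u_0(x)),\ 0<x<1,\qquad u_0'(0)=0,\quad u_0(1)\ge\delta u_0(\eta),$$ $$-(x^{\alpha}v_0'(x))'\le x^{\alpha}f(x,v_0(x)),\ 0<x<1,\qquad v_0'(0)=0,\quad v_0(1)\le\delta v_0(\eta);$$ (ii) $f:D_1\to\mathbb{R}$ is continuous on $D_1=\{(x,y)\in[0,1]\times\mathbb{R}: v_0(x)\le y\le u_0(x)\}$; (iii) there exists $M_2\ge 0$ such that for all $(x,y),(x,w)\in D_1$ with $y\le w$, $f(x,w)-f(x,y)\ge M_2(w-y)$; (iv) there exists a constant $\lambda>0$ such that $M_2-\lambda\ge 0$ and at least one of the following two conditions holds: (a) $\alpha\in\bigcup_{n\in\mathbb{N}}(4n-3,4n-1)$, $0<\lambda<j_{\nu,1}^2$, $0<\delta<1$, $\delta\eta^{\nu}J_{\nu}(\eta\sqrt{\lambda})-J_{\nu}(\sqrt{\lambda})\ge 0$ and $J_{-\nu}(\sqrt{\lambda})-\delta\eta^{\nu}J_{-\nu}(\eta\sqrt{\lambda})>0$; (b) $\alpha\in\{3,7,11,\dots\}$, $0<\lambda<y_{\nu,1}^2$, $0<\delta<1$, $\delta\eta^{\nu}Y_{\nu}(\eta\sqrt{\lambda})-Y_{\nu}(\sqrt{\lambda})\ge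 0$ and $J_{-\nu}(\sqrt{\lambda})-\delta\eta^{\nu}J_{-\nu}(\eta\sqrt{\lambda})>0$. Then the boundary value problem $$-(x^{\alpha}y'(x))'=x^{\alpha}f(x,y(x)),\ 0<x<1,\qquad y'(0)=0,\quad y(1)=\delta y(\eta)\qquad (\ast)$$ has at least one solution in the region $D_1$. The sequence $\{u_n\}$ generated by $$-y_{n+1}''(x)-\frac{\alpha}{x}y_{n+1}'(x)-\lambda y_{n+1}(x)=f(x,y_n(x))-\lambda y_n(x),\quad y_{n+1}'(0)=0,\quad y_{n+1}(1)=\delta y_{n+1}(\eta)$$ with initial iterate $y_0=u_0$ is monotonically non-increasing and converges uniformly to a solution $u$ of $(\ast)$. Similarly, with initial iterate $y_0=v_0$ the scheme gives a non-decreasing sequence $\{v_n\}$ converging to a solution $v$ of $(\ast)$. Any solution $z$ of $(\ast)$ in $D_1$ satisfies $v(x)\le z(x)\le u(x)$ for all $x\in[0,1]$.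
   Context: $\mathbb{N}=\{1,2,3,\dots\}$. $J_\mu$ and $Y_\mu$ denote the Bessel functions of the first and second kind of order $\mu$; $j_{\nu,1}$ and $y_{\nu,1}$ denote the first positive zeros of $J_\nu$ and $Y_\nu$ respectively. A solution is a function in $C[0,1]\cap C^2[0,1]$ satisfying the differential equation on $(0,1)$ and the boundary conditions; it is ''in the region $D_1$'' if $(x,y(x))\in D_1$ for all $x\in[0,1]$. *)

(* Defs.v *)
From Stdlib Require Import Reals Factorial Lra Lia.
From Coquelicot Require Import Coquelicot.
Open Scope R_scope.

(** * Bessel functions of real order, at positive arguments *)

(* 1 / Gamma(z), by Gauss's product formula
     1 / Gamma(z) = lim_n z (z+1) ... (z+n) / (n! n^z),
   valid for every real z; in particular it is 0 at 0, -1, -2, ... *)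
Definition recip_Gamma (z : R) : R :=
  real (Lim_seq (fun n : nat =>
    prod_f_R0 (fun k => z + INR k) n / (INR (fact n) * Rpower (INR n) z))).

(* Meaningful for x > 0 only, because of [Rpower]. *)
Definition BesselJ (mu x : R) : R :=
  Series (fun m : nat =>
    (-1) ^ m / INR (fact m) * recip_Gamma (INR m + mu + 1)
    * Rpower (x / 2) (2 * INR m + mu)).

Definition BesselY_quot (mu x : R) : R :=
  (BesselJ mu x * cos (mu * PI) - BesselJ (- mu) x) / sin (mu * PI).

(* At integer order, the limit of the quotient with respect to the order. *)
Definition BesselY (mu x : R) : R :=
  if Req_EM_T (sin (mu * PI)) 0
  then real (Lim (fun tau => BesselY_quot tau x) mu)
  else BesselY_quot mu x.

Definition is_first_positive_zero (g : R -> R) (z : R) : Prop :=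
  0 < z /\ g z = 0 /\ forall x, 0 < x < z -> g x <> 0.

(** * Functions on [0,1] *)

(* Functions on [0,1] are represented by total functions R -> R whose values
   outside [0,1] are irrelevant.  Hence derivatives on the closed interval are
   taken relatively to it (one-sided at 0 and 1), with [D_in]; at interior
   points this is the usual derivative [Derive]. *)
Definition I01 (x : R) : Prop := 0 <= x <= 1.

Definition C2_01 (y : R -> R) : Prop :=
  exists y1 y2 : R -> R,
    (forall x, I01 x -> D_in y y1 I01 x) /\
    (forall x, I01 x -> D_in y1 y2 I01 x) /\
    continuous_on I01 y2.

(* y'(0) = 0 *)
Definition zero_slope_at_0 (y : R -> R) : Prop := D_in y (fun _ => 0) I01 0.

(* -(x^alpha y'(x))', used for 0 < x < 1 only *)
Definition SL_op (alpha : R) (y : R -> R) (x : R) : R :=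
  - Derive (fun t => Rpower t alpha * Derive y t) x.

Definition unif_cv_01 (s : nat -> R -> R) (l : R -> R) : Prop :=
  forall eps, 0 < eps -> exists N : nat, forall n, (N <= n)%nat ->
    forall x, I01 x -> Rabs (s n x - l x) < eps.

(** * The three-point boundary value problem and the iteration *)

Definition upper_solution (alpha delta eta : R) (f : R -> R -> R)
    (u0 : R -> R) : Prop :=
  C2_01 u0 /\
  (forall x, 0 < x < 1 -> SL_op alpha u0 x >= Rpower x alpha * f x (u0 x)) /\
  zero_slope_at_0 u0 /\ u0 1 >= delta * u0 eta.

Definition lower_solution (alpha delta eta : R) (f : R -> R -> R)
    (v0 : R -> R) : Prop :=
  C2_01 v0 /\
  (forall x, 0 < x < 1 -> SL_op alpha v0 x <= Rpower x alpha * f x (v0 x)) /\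
  zero_slope_at_0 v0 /\ v0 1 <= delta * v0 eta.

Definition bvp_solution (alpha delta eta : R) (f : R -> R -> R)
    (y : R -> R) : Prop :=
  C2_01 y /\
  (forall x, 0 < x < 1 -> SL_op alpha y x = Rpower x alpha * f x (y x)) /\
  zero_slope_at_0 y /\ y 1 = delta * y eta.

Definition region (v0 u0 : R -> R) (p : R * R) : Prop :=
  I01 (fst p) /\ v0 (fst p) <= snd p <= u0 (fst p).

Definition in_region (v0 u0 y : R -> R) : Prop :=
  forall x, I01 x -> region v0 u0 (x, y x).

(* [yn] is the iterate that follows [y]. *)
Definition next_iterate (alpha delta eta lambda : R) (f : R -> R -> R)
    (y yn : R -> R) : Prop :=
  C2_01 yn /\
  (forall x, 0 < x < 1 ->
     - Derive_n yn 2 x - alpha / x * Derive yn x - lambda * yn x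
     = f x (y x) - lambda * y x) /\
  zero_slope_at_0 yn /\ yn 1 = delta * yn eta.

Definition iteration (alpha delta eta lambda : R) (f : R -> R -> R)
    (y0 : R -> R) (s : nat -> R -> R) : Prop :=
  (forall x, I01 x -> s O x = y0 x) /\
  (forall n, next_iterate alpha delta eta lambda f (s n) (s (S n))).

(* [s] is the sequence generated by the scheme from [y0]: an iteration, and
   the only one up to values outside [0,1]. *)
Definition generated (alpha delta eta lambda : R) (f : R -> R -> R)
    (y0 : R -> R) (s : nat -> R -> R) : Prop :=
  iteration alpha delta eta lambda f y0 s /\
  forall s', iteration alpha delta eta lambda f y0 s' ->
    forall n x, I01 x -> s' n x = s n x.

(** * The two alternative conditions on lambda, delta, eta *)

Definition condition_a (alpha delta eta nu lambda : R) : Prop :=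
  (exists n : nat, (1 <= n)%nat /\ 4 * INR n - 3 < alpha < 4 * INR n - 1) /\
  (exists j, is_first_positive_zero (BesselJ nu) j /\ 0 < lambda < j ^ 2) /\
  0 < delta < 1 /\
  delta * Rpower eta nu * BesselJ nu (eta * sqrt lambda)
    - BesselJ nu (sqrt lambda) >= 0 /\
  BesselJ (- nu) (sqrt lambda)
    - delta * Rpower eta nu * BesselJ (- nu) (eta * sqrt lambda) > 0.

Definition condition_b (alpha delta eta nu lambda : R) : Prop :=
  (exists n : nat, (1 <= n)%nat /\ alpha = 4 * INR n - 1) /\
  (exists z, is_first_positive_zero (BesselY nu) z /\ 0 < lambda < z ^ 2) /\
  0 < delta < 1 /\
  delta * Rpower eta nu * BesselY nu (eta * sqrt lambda)
    - BesselY nu (sqrt lambda) >= 0 /\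
  BesselJ (- nu) (sqrt lambda)
    - delta * Rpower eta nu * BesselJ (- nu) (eta * sqrt lambda) > 0.

(* Main.v *)
Require Import Defs.
From Stdlib Require Import Reals Factorial Lra Lia Classical IndefiniteDescription.
From Coquelicot Require Import Coquelicot.
Open Scope R_scope.

(** Write [L y = y'' + (alpha/x) y'], so that [(x^alpha y')' = x^alpha L y], and
    let [phi] be the solution of [L phi + lambda phi = 0] that is regular at 0,
    with [phi 0 = 1]; it is a multiple of [x^nu J_{-nu}(x sqrt lambda)].  Two facts
    about [phi] carry the proof: [phi 1 > delta * phi eta], and [phi > 0] on
    [[0,1]].

    The first is the inequality between values of [J_{-nu}], because the multiple
    is nonnegative ([regular_gap]).  The second is extracted from the pair of lower
    and upper solutions ([regular_pos]).  The difference [w = u0 - v0] is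
    nonnegative and, by the one-sided Lipschitz condition and [lambda <= M2],
    satisfies [L w + lambda w <= 0].  If [w] is not identically zero, it is positive
    on [[0,1]], since [x^alpha w'] decreases from 0 and [w 1 >= delta * w eta].
    The Wronskian [x^alpha (phi w' - phi' w)] decreases from 0 as long as
    [phi > 0], whereas at a first zero of [phi] it would be positive.

    Since [phi > 0], the quotient [y / phi] of every [y] with
    [L y + lambda y <= 0] is nonincreasing, and then [y 1 >= delta * y eta]
    together with [phi 1 > delta * phi eta] forces [y >= 0]
    ([maximum_principle]).  Reduction of order, [y = phi z], solves the linear
    three-point problem for every continuous right-hand side
    ([linear_bvp_solvable]).  As [f x y - lambda y] is nondecreasing in [y], the
    map from an iterate to the next one preserves the order and the region, it
    lowers [u0] and raises [v0], and its fixed points are the solutions of the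
    boundary value problem; so both sequences are monotone and enclose every
    solution.

    The iterates have uniformly bounded slopes, so their pointwise limit [u] is
    continuous, and Dini's theorem gives uniform convergence of the iterates and of
    the right-hand sides [f x (u_n x) - lambda * u_n x].  If [U] solves the linear
    problem with the limit right-hand side, the maximum principle bounds
    [u_{n+1} - U] by [eps * P], where [P] solves the linear problem with right-hand
    side 1; hence [u = U] is a solution ([iteration_converges]).

    If [u0 = v0] on [[0,1]], this common function is both an upper and a lower
    solution, hence a solution, and the iteration is constant.  That it is the only
    iteration follows from [phi 1 <> delta * phi eta] alone, because two solutions
    of the homogeneous equation with zero slope at 0 are proportional by the decay
    of the energy [y'^2 + lambda y^2] ([energy_uniqueness]). *)

(** * Calculus relative to [0,1] *)

Definition clamp (x : R) : R := Rmax 0 (Rmin 1 x).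

Lemma clamp_I01 x : I01 (clamp x).
Proof. unfold clamp, I01, Rmax, Rmin. destruct (Rle_dec 1 x); destruct (Rle_dec 0 _); lra. Qed.

Lemma clamp_id x : I01 x -> clamp x = x.
Proof.
  unfold clamp, I01, Rmax, Rmin. intros.
  destruct (Rle_dec 1 x); destruct (Rle_dec 0 _); lra.
Qed.

Lemma clamp_dist x y : Rabs (clamp x - clamp y) <= Rabs (x - y).
Proof.
  unfold clamp, Rmax, Rmin.
  destruct (Rle_dec 1 x), (Rle_dec 1 y);
    repeat destruct (Rle_dec 0 _); unfold Rabs; repeat destruct (Rcase_abs _); lra.
Qed.

(** Composing with the projection [clamp] onto [[0,1]] turns continuity relative
    to the interval into continuity on the whole line, where limits, products
    and integrals need no one-sided variants. *)
Definition cont01 (g : R -> R) : Prop :=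
  forall x, continuous (fun t => g (clamp t)) x.

Lemma continuous_on_cont01 g : continuous_on I01 g <-> cont01 g.
Proof.
  split.
  - intros H x. apply filterlim_locally. intros eps.
    generalize (proj1 (filterlim_locally _ _) (H (clamp x) (clamp_I01 x)) eps).
    intros [d Hd]. exists d. intros t Ht. apply Hd; [|apply clamp_I01].
    eapply Rle_lt_trans; [|exact Ht]. apply (clamp_dist t x).
  - intros H x Hx.
    apply filterlim_locally. intros eps.
    generalize (proj1 (filterlim_locally _ _) (H x) eps).
    intros [d Hd]. exists d. intros t Ht Ht'. specialize (Hd t Ht).
    simpl in Hd. rewrite !clamp_id in Hd; assumption.
Qed.

Lemma cont01_ext g h : (forall x, I01 x -> g x = h x) -> cont01 g -> cont01 h.
Proof.
  intros E H x. apply continuous_ext with (2 := H x).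
  intros t. apply E, clamp_I01.
Qed.

Lemma cont01_of_continuous g : (forall x, I01 x -> continuous g x) -> cont01 g.
Proof.
  intros H. apply continuous_on_cont01. now apply continuous_on_forall.
Qed.

Lemma D_in_cont01 g dg : (forall x, I01 x -> D_in g dg I01 x) -> cont01 g.
Proof.
  intros H. apply continuous_on_cont01. intros x Hx.
  generalize (cont_deriv _ _ _ _ (H x Hx)). intros C.
  apply filterlim_locally. intros eps.
  destruct (C eps (cond_pos eps)) as [d [Hd Hd']].
  exists (mkposreal d Hd). intros t Ht Ht'.
  destruct (Req_dec t x) as [->|n]. apply ball_center.
  apply (Hd' t). split; [split|]; auto.
Qed.

Lemma D_in_interior g dg x :
  0 < x < 1 -> D_in g dg I01 x -> is_derive g x (dg x).
Proof.
  intros Hx H. apply is_derive_Reals, derivable_pt_lim_D_in.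
  intros eps Heps. destruct (H eps Heps) as [d [Hd Hd']].
  exists (Rmin d (Rmin x (1 - x))). split.
  { repeat apply Rmin_glb_lt; lra. }
  intros t [[_ Ht] Ht']. apply Hd'.
  assert (Rabs (t - x) < d /\ Rabs (t - x) < x /\ Rabs (t - x) < 1 - x) as (A & B & C).
  { repeat split; (eapply Rlt_le_trans; [exact Ht'|]).
    apply Rmin_l.
    eapply Rle_trans; [apply Rmin_r|apply Rmin_l].
    eapply Rle_trans; [apply Rmin_r|apply Rmin_r]. }
  split; [split|]; auto.
  apply Rabs_def2 in B. apply Rabs_def2 in C. unfold I01; lra.
Qed.

Lemma is_derive_D_in g dg D x : is_derive g x (dg x) -> D_in g dg D x.
Proof.
  intros H. apply is_derive_Reals, derivable_pt_lim_D_in in H.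
  intros eps Heps. destruct (H eps Heps) as [d [Hd Hd']].
  exists d. split; auto. intros t [[? ?] ?]. apply Hd'. repeat split; auto.
Qed.

(** The point 0 is a limit point of [[0,1]], so the one-sided slope at 0 is
    unique. *)
Lemma D_in_unique_at_0 g dg dg' : D_in g dg I01 0 -> D_in g dg' I01 0 -> dg 0 = dg' 0.
Proof.
  intros H H'. eapply single_limit; [|exact H|exact H'].
  intros a Ha. exists (Rmin 1 (a / 2)).
  assert (0 < Rmin 1 (a/2)) by (apply Rmin_glb_lt; lra).
  assert (A := Rmin_l 1 (a/2)). assert (B := Rmin_r 1 (a/2)).
  split; [split; unfold I01; lra|].
  unfold Rdist. rewrite Rminus_0_r, Rabs_pos_eq; lra.
Qed.

Lemma clamp_id_locally x : 0 < x < 1 -> locally x (fun t => clamp t = t).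
Proof.
  intros Hx. assert (He : 0 < Rmin x (1 - x)) by (apply Rmin_glb_lt; lra).
  exists (mkposreal _ He). intros t Ht. apply clamp_id.
  assert (A := Rmin_l x (1 - x)). assert (B := Rmin_r x (1 - x)).
  apply Rabs_def2 in Ht. simpl in Ht. unfold minus, plus, opp in Ht; simpl in Ht.
  unfold I01; lra.
Qed.

(** Continuity up to the end points and a derivative inside is what is known of
    the flux [x^alpha y'], since the weight is not differentiable at 0 when
    [alpha = 1]. *)
Lemma mvt01 g dg a b : cont01 g -> 0 <= a < b -> b <= 1 ->
  (forall x, a < x < b -> is_derive g x (dg x)) ->
  exists c, a < c < b /\ g b - g a = dg c * (b - a).
Proof.
  intros Hg Hab Hb Hd.
  assert (L : forall c, a < c < b -> derivable_pt_lim (fun t => g (clamp t)) c (dg c)).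
  { intros c Hc. apply is_derive_Reals.
    apply is_derive_ext_loc with (2 := Hd c Hc).
    generalize (clamp_id_locally c ltac:(lra)). apply filter_imp.
    intros t ->. reflexivity. }
  set (P := fun c Hc => exist _ (dg c) (L c Hc) : derivable_pt (fun t => g (clamp t)) c).
  destruct (MVT (fun t => g (clamp t)) id a b P (fun c _ => derivable_pt_id c)) as (c & Hc & E).
  - lra.
  - intros c Hc. apply continuity_pt_filterlim, Hg.
  - intros c Hc. apply derivable_continuous_pt, derivable_pt_id.
  - exists c. split; auto.
    rewrite (derive_pt_id c), (derive_pt_eq_0 _ _ _ (P c Hc) (L c Hc)) in E.
    rewrite !clamp_id in E by (unfold I01; lra). unfold id in E. lra.
Qed.

Lemma noninc01 g dg a b : cont01 g -> 0 <= a <= b -> b <= 1 ->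
  (forall x, a < x < b -> is_derive g x (dg x)) ->
  (forall x, a < x < b -> dg x <= 0) -> g b <= g a.
Proof.
  intros Hg Hab Hb Hd Hs. destruct (Req_dec a b) as [->|n]; [lra|].
  destruct (mvt01 g dg a b) as (c & Hc & E); auto; try lra.
  specialize (Hs c Hc). nra.
Qed.

Lemma decr01 g dg a b : cont01 g -> 0 <= a < b -> b <= 1 ->
  (forall x, a < x < b -> is_derive g x (dg x)) ->
  (forall x, a < x < b -> dg x < 0) -> g b < g a.
Proof.
  intros Hg Hab Hb Hd Hs.
  destruct (mvt01 g dg a b) as (c & Hc & E); auto; try lra.
  specialize (Hs c Hc). nra.
Qed.

(** * The weight x^alpha and twice differentiable functions on [0,1] *)

(** The value 0 for [x <= 0] makes the weight continuous at 0; there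
    [Rpower 0 alpha] is 1. *)
Definition weight (alpha x : R) : R := if Rlt_dec 0 x then Rpower x alpha else 0.

Lemma weight_Rpower alpha x : 0 < x -> weight alpha x = Rpower x alpha.
Proof. intros H. unfold weight. destruct (Rlt_dec 0 x); [reflexivity|lra]. Qed.

Lemma weight_pos alpha x : 0 < x -> 0 < weight alpha x.
Proof. intros H. rewrite weight_Rpower by assumption. apply exp_pos. Qed.

Lemma weight_0 alpha : weight alpha 0 = 0.
Proof. unfold weight. destruct (Rlt_dec 0 0); lra. Qed.

Lemma is_derive_weight alpha x : 0 < x ->
  is_derive (weight alpha) x (alpha / x * weight alpha x).
Proof.
  intros H. apply is_derive_ext_loc with (fun t => exp (alpha * ln t)).
  - exists (mkposreal x H). intros t Ht. symmetry. apply weight_Rpower.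
    apply Rabs_def2 in Ht. simpl in Ht. unfold minus, plus, opp in Ht; simpl in Ht. lra.
  - rewrite weight_Rpower by assumption. unfold Rpower. auto_derive; [exact H|field; lra].
Qed.

(** For [alpha >= 1] the weight lies between 0 and [x] on [(0,1)], which gives
    continuity at 0. *)
Lemma continuous_weight alpha x : 1 <= alpha -> continuous (weight alpha) x.
Proof.
  intros Ha. destruct (Rlt_dec 0 x) as [H|H].
  - apply (ex_derive_continuous (weight alpha)). eexists. apply is_derive_weight, H.
  - assert (B : forall t, Rabs t < 1 -> 0 <= weight alpha t <= Rabs t).
    { intros t Ht. destruct (Rlt_dec 0 t) as [p|p].
      - rewrite Rabs_pos_eq in * by lra. split; [left; now apply weight_pos|].
        rewrite weight_Rpower by assumption. rewrite <- (Rpower_1 t) at 2 by assumption.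
        assert (Hl : ln t < 0) by (rewrite <- ln_1; now apply ln_increasing).
        unfold Rpower. destruct (Req_dec alpha 1) as [->|n]; [lra|].
        left. apply exp_increasing. nra.
      - unfold weight. destruct (Rlt_dec 0 t); [lra|]. split; [lra|apply Rabs_pos]. }
    destruct (Req_dec x 0) as [->|n].
    + apply filterlim_locally. intros eps. rewrite weight_0.
      assert (He : 0 < Rmin 1 eps) by (apply Rmin_glb_lt; [lra|apply cond_pos]).
      exists (mkposreal _ He). intros t Ht.
      unfold ball in *; simpl in *. unfold AbsRing_ball, abs, minus, plus, opp in *; simpl in *.
      rewrite Ropp_0, Rplus_0_r in *.
      assert (A := Rmin_l 1 eps). assert (C := Rmin_r 1 eps).
      specialize (B t ltac:(lra)). rewrite Rabs_pos_eq; lra.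
    + assert (Hx : 0 < - x) by lra.
      apply continuous_ext_loc with (fun _ => 0); [|apply continuous_const].
      exists (mkposreal _ Hx). intros t Ht.
      apply Rabs_def2 in Ht. simpl in Ht. unfold minus, plus, opp in Ht; simpl in Ht.
      unfold weight. destruct (Rlt_dec 0 t); lra.
Qed.

(** A function of class C2 on [[0,1]] together with its two derivatives, so that
    the derivatives at the end points are available as functions. *)
Definition jet (y y1 y2 : R -> R) : Prop :=
  (forall x, I01 x -> D_in y y1 I01 x) /\
  (forall x, I01 x -> D_in y1 y2 I01 x) /\
  continuous_on I01 y2.

(** The operator [y'' + (alpha/x) y'], which is the radial Laplacian in
    dimension [alpha + 1]; [x^alpha] times it is the derivative of the flux
    [x^alpha y']. *)
Definition radial_op (alpha : R) (y1 y2 : R -> R) (x : R) : R :=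
  y2 x + alpha / x * y1 x.

Lemma jet_derive y y1 y2 x : jet y y1 y2 -> 0 < x < 1 ->
  is_derive y x (y1 x) /\ is_derive y1 x (y2 x).
Proof.
  intros (H & H' & _) Hx.
  split; apply D_in_interior; auto; [apply H | apply H']; unfold I01; lra.
Qed.

Lemma jet_cont y y1 y2 : jet y y1 y2 -> cont01 y /\ cont01 y1 /\ cont01 y2.
Proof.
  intros (H & H' & H2). repeat split.
  - now apply D_in_cont01 with y1.
  - now apply D_in_cont01 with y2.
  - now apply continuous_on_cont01.
Qed.

Lemma cont01_plus g h : cont01 g -> cont01 h -> cont01 (fun x => g x + h x).
Proof. intros G H x. apply (continuous_plus (fun t => g (clamp t)) (fun t => h (clamp t))); auto. Qed.

Lemma cont01_mult g h : cont01 g -> cont01 h -> cont01 (fun x => g x * h x).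
Proof. intros G H x. apply (continuous_mult (fun t => g (clamp t)) (fun t => h (clamp t))); auto. Qed.

Lemma cont01_const c : cont01 (fun _ => c).
Proof. intros x. apply continuous_const. Qed.

Lemma cont01_scal c g : cont01 g -> cont01 (fun x => c * g x).
Proof. intros. apply cont01_mult; auto using cont01_const. Qed.

Lemma cont01_minus g h : cont01 g -> cont01 h -> cont01 (fun x => g x - h x).
Proof.
  intros G H x. apply (continuous_minus (fun t => g (clamp t)) (fun t => h (clamp t))); auto.
Qed.

Lemma jet_lin a b y y1 y2 z z1 z2 : jet y y1 y2 -> jet z z1 z2 ->
  jet (fun x => a * y x + b * z x) (fun x => a * y1 x + b * z1 x)
      (fun x => a * y2 x + b * z2 x).
Proof.
  intros Hy Hz. assert (Cy := jet_cont _ _ _ Hy). assert (Cz := jet_cont _ _ _ Hz).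
  destruct Hy as (Y & Y1 & _), Hz as (Z & Z1 & _).
  repeat split.
  - intros x Hx. apply (Dadd _ (fun x => a * y1 x) (fun x => b * z1 x) (fun x => a * y x) (fun x => b * z x));
      now apply Dmult_const; auto.
  - intros x Hx. apply (Dadd _ (fun x => a * y2 x) (fun x => b * z2 x) (fun x => a * y1 x) (fun x => b * z1 x));
      now apply Dmult_const; auto.
  - apply continuous_on_cont01. apply cont01_plus; apply cont01_scal; tauto.
Qed.

Lemma jet_of_derive y y1 y2 :
  (forall x, I01 x -> is_derive y x (y1 x)) ->
  (forall x, I01 x -> is_derive y1 x (y2 x)) ->
  cont01 y2 -> jet y y1 y2.
Proof.
  intros H H' C. repeat split; intros.
  - now apply is_derive_D_in, H.
  - now apply is_derive_D_in, H'.
  - now apply continuous_on_cont01.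
Qed.

Lemma jet_flux_derive alpha y y1 y2 x : jet y y1 y2 -> 0 < x < 1 ->
  is_derive (fun t => weight alpha t * y1 t) x (weight alpha x * radial_op alpha y1 y2 x).
Proof.
  intros H Hx. destruct (jet_derive _ _ _ x H Hx) as [_ D].
  evar_last.
  - apply (Derive.is_derive_mult (weight alpha) y1); [apply is_derive_weight; lra|exact D].
  - unfold radial_op. ring.
Qed.

Lemma cont01_weight alpha : 1 <= alpha -> cont01 (weight alpha).
Proof. intros. apply cont01_of_continuous. intros. now apply continuous_weight. Qed.

Lemma jet_interior_locally y y1 y2 x : jet y y1 y2 -> 0 < x < 1 ->
  locally x (fun t => Derive y t = y1 t).
Proof.
  intros H Hx. 
  assert (L : locally x (fun t => 0 < t < 1)).
  { apply filter_and; [apply (open_gt 0 x)|apply (open_lt 1 x)]; lra. }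
  revert L. apply filter_imp. intros t Ht.
  apply is_derive_unique. now apply (jet_derive y y1 y2).
Qed.

Lemma jet_Derive_n2 y y1 y2 x : jet y y1 y2 -> 0 < x < 1 ->
  Derive_n y 2 x = y2 x.
Proof.
  intros H Hx. simpl.
  erewrite Derive_ext_loc; [|apply (jet_interior_locally y y1 y2 x H Hx)].
  apply is_derive_unique. now apply (jet_derive y y1 y2).
Qed.

Lemma SL_op_radial alpha y y1 y2 x : jet y y1 y2 -> 0 < x < 1 ->
  SL_op alpha y x = - (Rpower x alpha * radial_op alpha y1 y2 x).
Proof.
  intros H Hx. unfold SL_op. f_equal. rewrite <- weight_Rpower by lra.
  apply is_derive_unique.
  apply is_derive_ext_loc with (2 := jet_flux_derive alpha y y1 y2 x H Hx).
  generalize (jet_interior_locally y y1 y2 x H Hx).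
  assert (L : locally x (fun t => 0 < t)) by (apply (open_gt 0 x); lra).
  intros L'. generalize (filter_and _ _ L L'). apply filter_imp.
  intros t [Ht ->]. now rewrite weight_Rpower.
Qed.

Lemma zero_slope_jet y y1 y2 : jet y y1 y2 -> (zero_slope_at_0 y <-> y1 0 = 0).
Proof.
  intros (H & _). assert (H0 : D_in y y1 I01 0) by (apply H; unfold I01; lra).
  split.
  - intros Z. exact (D_in_unique_at_0 _ _ _ H0 Z).
  - intros E. unfold D_in in H0. rewrite E in H0. exact H0.
Qed.

(** * The regular solution of the homogeneous equation *)

(** The recurrence comes from inserting [y = G(x^2)] in
    [y'' + (alpha/x) y' + lambda y = 0], which turns it into
    [t G'' + (alpha+1)/2 G' + lambda/4 G = 0]. *)
Fixpoint regular_coef (alpha lambda : R) (m : nat) : R :=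
  match m with
  | O => 1
  | S k => regular_coef alpha lambda k * (- lambda / 4)
             / ((INR k + 1) * (INR k + (alpha + 1) / 2))
  end.

(** The function called [phi] in the comments; [regular1] and [regular2] are its
    first two derivatives. *)
Definition regular (alpha lambda x : R) : R :=
  PSeries (regular_coef alpha lambda) (x ^ 2).
Definition regular1 (alpha lambda x : R) : R :=
  2 * x * PSeries (PS_derive (regular_coef alpha lambda)) (x ^ 2).
Definition regular2 (alpha lambda x : R) : R :=
  2 * PSeries (PS_derive (regular_coef alpha lambda)) (x ^ 2)
  + 4 * x ^ 2 * PSeries (PS_derive (PS_derive (regular_coef alpha lambda))) (x ^ 2).

Lemma regular_coef_neq_0 alpha lambda m :
  1 <= alpha -> 0 < lambda -> regular_coef alpha lambda m <> 0.
Proof.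
  intros Ha Hl. induction m as [|k IH]; simpl; [lra|].
  assert (K := pos_INR k).
  unfold Rdiv. repeat apply Rmult_integral_contrapositive_currified; try lra; auto.
  apply Rinv_neq_0_compat. apply Rgt_not_eq. apply Rmult_lt_0_compat; lra.
Qed.

Lemma regular_coef_radius alpha lambda :
  1 <= alpha -> 0 < lambda -> CV_radius (regular_coef alpha lambda) = p_infty.
Proof.
  intros Ha Hl. apply CV_radius_infinite_DAlembert.
  { intros n. now apply regular_coef_neq_0. }
  apply is_lim_seq_le_le with (u := fun _ => 0) (w := fun n => lambda * / (INR n + 1)).
  - intros n. split; [apply Rabs_pos|]. simpl.
    assert (K := pos_INR n).
    assert (N := regular_coef_neq_0 alpha lambda n Ha Hl).
    replace (_ / regular_coef alpha lambda n) with
      (- ((lambda / 4) / ((INR n + 1) * (INR n + (alpha + 1) / 2)))) by (field; repeat split; lra).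
    rewrite Rabs_Ropp, Rabs_pos_eq.
    + unfold Rdiv. rewrite Rinv_mult, Rmult_assoc. apply Rmult_le_compat_l; [lra|].
      rewrite (Rmult_comm (/ (INR n + 1))), <- Rmult_assoc.
      rewrite <- (Rmult_1_l (/ (INR n + 1))) at 2.
      apply Rmult_le_compat_r. left; apply Rinv_0_lt_compat; lra.
      apply Rmult_le_reg_r with (INR n + (alpha + 1) * / 2); [lra|].
      rewrite Rmult_assoc, Rinv_l by lra. lra.
    + apply Rmult_le_pos; [lra|]. left. apply Rinv_0_lt_compat.
      apply Rmult_lt_0_compat; lra.
  - apply is_lim_seq_const.
  - replace (Finite 0) with (Rbar_mult lambda 0) by (simpl; f_equal; ring).
    apply is_lim_seq_scal_l.
    replace (Finite 0) with (Rbar_inv p_infty) by reflexivity.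
    apply is_lim_seq_inv; [|discriminate].
    apply is_lim_seq_ext with (fun n => INR (S n)).
    { intros n. apply S_INR. }
    apply -> (is_lim_seq_incr_1 INR). apply is_lim_seq_INR.
Qed.

Lemma ex_pseries_infinite_radius a t : CV_radius a = p_infty -> ex_pseries a t.
Proof. intros H. apply CV_radius_inside. rewrite H. exact I. Qed.

Lemma derive_PSeries_sq a x : CV_radius a = p_infty ->
  is_derive (fun x => PSeries a (x ^ 2)) x (2 * x * PSeries (PS_derive a) (x ^ 2)).
Proof.
  intros H. evar_last.
  - apply (is_derive_comp (PSeries a) (fun x => x ^ 2)).
    + apply is_derive_PSeries. rewrite H. exact I.
    + apply is_derive_pow, @is_derive_id.
  - unfold scal; simpl; unfold mult; simpl. unfold one; simpl. ring.
Qed.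

Section Regular.
Variables alpha lambda : R.
Hypothesis Ha : 1 <= alpha.
Hypothesis Hl : 0 < lambda.
Let c := regular_coef alpha lambda.

Let Rc : CV_radius c = p_infty.
Proof. now apply regular_coef_radius. Qed.
Let Rc1 : CV_radius (PS_derive c) = p_infty.
Proof. rewrite CV_radius_derive. apply Rc. Qed.
Let Rc2 : CV_radius (PS_derive (PS_derive c)) = p_infty.
Proof. rewrite CV_radius_derive. apply Rc1. Qed.

Lemma is_derive_regular x : is_derive (regular alpha lambda) x (regular1 alpha lambda x).
Proof. apply derive_PSeries_sq, Rc. Qed.

Lemma is_derive_regular1 x : is_derive (regular1 alpha lambda) x (regular2 alpha lambda x).
Proof.
  evar_last.
  - apply (Derive.is_derive_mult (fun x => 2 * x) (fun x => PSeries (PS_derive c) (x ^ 2))).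
    + apply is_derive_scal, @is_derive_id.
    + apply derive_PSeries_sq, Rc1.
  - unfold regular2, c. unfold one; simpl. ring.
Qed.

Lemma continuous_regular2 x : continuous (regular2 alpha lambda) x.
Proof.
  apply (ex_derive_continuous (regular2 alpha lambda)).
  eexists. apply (is_derive_plus (fun x => 2 * PSeries (PS_derive c) (x ^ 2))
    (fun x => 4 * x ^ 2 * PSeries (PS_derive (PS_derive c)) (x ^ 2))).
  - apply is_derive_scal, derive_PSeries_sq, Rc1.
  - apply (Derive.is_derive_mult (fun x => 4 * x ^ 2)).
    + apply is_derive_scal. apply is_derive_pow, @is_derive_id.
    + apply derive_PSeries_sq, Rc2.
Qed.

Lemma regular_jet :
  jet (regular alpha lambda) (regular1 alpha lambda) (regular2 alpha lambda).
Proof.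
  apply jet_of_derive; intros.
  - apply is_derive_regular.
  - apply is_derive_regular1.
  - apply cont01_of_continuous. intros. apply continuous_regular2.
Qed.

Lemma regular_at_0 : regular alpha lambda 0 = 1.
Proof. unfold regular. rewrite pow_i by lia. apply PSeries_0. Qed.

Lemma regular1_at_0 : regular1 alpha lambda 0 = 0.
Proof. unfold regular1. ring. Qed.

(** With [t = x^2] the equation is an identity between power series in [t],
    which holds coefficientwise by the recurrence. *)
Lemma regular_ode x : 0 < x ->
  radial_op alpha (regular1 alpha lambda) (regular2 alpha lambda) x
  = - lambda * regular alpha lambda x.
Proof.
  intros Hx.
  assert (E : forall t, t * PSeries (PS_derive (PS_derive c)) t
      + (alpha + 1) / 2 * PSeries (PS_derive c) t = - lambda / 4 * PSeries c t).
  { intros t. rewrite <- PSeries_incr_1, <- !PSeries_scal.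
    rewrite <- PSeries_plus.
    - apply PSeries_ext. intros n. unfold PS_plus, PS_scal.
      unfold plus, scal; simpl; unfold mult; simpl.
      destruct n as [|n]; unfold PS_incr_1, PS_derive; cbn [regular_coef c];
        unfold c; cbn [regular_coef].
      + unfold zero; simpl. field. lra.
      + rewrite !S_INR. assert (K := pos_INR n). field. repeat split; lra.
    - apply ex_pseries_infinite_radius. rewrite <- Rc2. apply CV_radius_incr_1.
    - apply ex_pseries_infinite_radius. rewrite CV_radius_scal; [apply Rc1|]. lra. }
  specialize (E (x ^ 2)). unfold radial_op, regular1, regular2, regular. fold c.
  replace (- lambda * PSeries c (x ^ 2)) with (4 * (- lambda / 4 * PSeries c (x ^ 2))) by field.
  rewrite <- E. field. lra.
Qed.
End Regular.

(** * The regular solution as a Bessel function *)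

(** The terms of Gauss's product for [1 / Gamma(z)]. *)
Definition gauss_quotient (z : R) (n : nat) : R :=
  prod_f_R0 (fun k => z + INR k) n / (INR (fact n) * Rpower (INR n) z).

Lemma gauss_quotient_pos z n : 0 < z -> 0 < gauss_quotient z n.
Proof.
  intros Hz. unfold gauss_quotient. apply Rdiv_lt_0_compat.
  - induction n as [|n IH]; cbn [prod_f_R0]; [simpl; lra|].
    apply Rmult_lt_0_compat; [exact IH|]. assert (K := pos_INR (S n)). lra.
  - apply Rmult_lt_0_compat; [apply INR_fact_lt_0|apply exp_pos].
Qed.

(** The ratio of consecutive terms is [(1 + z s) (1 - s)^z] with [s = 1/(m+1)],
    and both factors are controlled by the exponential: [1 + z s <= exp (z s)]
    and [1 - s <= exp (- s)]. *)
Lemma gauss_quotient_decr z n : 0 < z ->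
  gauss_quotient z (S (S n)) <= gauss_quotient z (S n).
Proof.
  intros Hz. assert (G := gauss_quotient_pos z (S n) Hz). revert G.
  unfold gauss_quotient. set (m := S n). cbn [prod_f_R0].
  rewrite fact_simpl, mult_INR.
  assert (M : 1 <= INR m) by (apply (le_INR 1); unfold m; lia).
  assert (M1 : INR (S m) = INR m + 1) by apply S_INR.
  set (P := prod_f_R0 _ m). set (F := INR (fact m)).
  assert (0 < F) by apply INR_fact_lt_0.
  assert (E0 : 0 < Rpower (INR m) z) by apply exp_pos.
  assert (E1 : 0 < Rpower (INR (S m)) z) by apply exp_pos.
  intros G.
  assert (K : (1 + z / INR (S m)) * Rpower (INR m) z <= Rpower (INR (S m)) z).
  { rewrite M1 in *. set (s := / (INR m + 1)).
    assert (Hs : 0 < s) by (apply Rinv_0_lt_compat; lra).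
    assert (Hs' : (INR m + 1) * s = 1) by (apply Rinv_r; lra).
    assert (L : ln (INR m) <= ln (INR m + 1) - s).
    { replace (INR m) with ((INR m + 1) * (1 - s)) at 1 by nra.
      assert (0 < 1 - s) by nra.
      rewrite ln_mult by lra.
      assert (ln (1 - s) <= - s); [|lra].
      rewrite <- (ln_exp (- s)). apply ln_le; [lra|].
      generalize (exp_ineq1_le (- s)). lra. }
    apply Rle_trans with (exp (z * s) * Rpower (INR m) z).
    - apply Rmult_le_compat_r; [lra|]. unfold Rdiv. apply exp_ineq1_le.
    - unfold Rpower. rewrite <- exp_plus.
      destruct (Rmult_le_compat_l z _ _ (Rlt_le _ _ Hz) L) as [h|h].
      + left. apply exp_increasing. lra.
      + right. f_equal. lra. }
  replace (P * (z + INR (S m)) / (INR (S m) * F * Rpower (INR (S m)) z))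
    with (P / (F * Rpower (INR m) z) *
          (((1 + z / INR (S m)) * Rpower (INR m) z) / Rpower (INR (S m)) z)).
  2:{ rewrite M1 in *. field. repeat split; lra. }
  rewrite <- (Rmult_1_r (P / (F * Rpower (INR m) z))) at 2.
  apply Rmult_le_compat_l; [lra|].
  apply Rmult_le_reg_r with (1 := E1). unfold Rdiv.
  rewrite Rmult_assoc, Rinv_l by lra. lra.
Qed.

(** Gauss's quotients are positive and decrease, so they have a finite
    nonnegative limit. Nonnegativity suffices for the sign argument of
    [regular_gap]. *)
Lemma recip_Gamma_lim z : 0 < z ->
  is_lim_seq (gauss_quotient z) (recip_Gamma z) /\ 0 <= recip_Gamma z.
Proof.
  intros Hz.
  destruct (ex_finite_lim_seq_decr (fun n => gauss_quotient z (S n)) 0) as [l L].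
  - intros n. now apply gauss_quotient_decr.
  - intros n. left. now apply gauss_quotient_pos.
  - apply (is_lim_seq_incr_1 (gauss_quotient z)) in L.
    assert (E : recip_Gamma z = l).
    { unfold recip_Gamma. erewrite is_lim_seq_unique by exact L. reflexivity. }
    rewrite E. split; [exact L|].
    apply (is_lim_seq_le (fun _ => 0) (gauss_quotient z) 0 l); auto using is_lim_seq_const.
    intros n. left. now apply gauss_quotient_pos.
Qed.

(** The quotients at [z + 1] and at [z] differ by the factor
    [(z + n + 1) / (n z)], which tends to [1 / z]. *)
Lemma recip_Gamma_succ z : 0 < z -> recip_Gamma (z + 1) = recip_Gamma z / z.
Proof.
  intros Hz.
  destruct (recip_Gamma_lim z Hz) as [L _].
  destruct (recip_Gamma_lim (z + 1)) as [L1 _]; [lra|].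
  assert (P : forall n, z * prod_f_R0 (fun k => z + 1 + INR k) n
                        = prod_f_R0 (fun k => z + INR k) n * (z + INR n + 1)).
  { induction n as [|n IH]; cbn [prod_f_R0]; [simpl; ring|].
    rewrite <- Rmult_assoc, IH, S_INR. ring. }
  assert (Q : is_lim_seq (fun n => (1 + (z + 1) / INR n) / z) (/ z)).
  { replace (/ z) with ((1 + (z + 1) * 0) * / z) by ring.
    apply (is_lim_seq_scal_r (fun n => 1 + (z + 1) / INR n) (/ z) (1 + (z + 1) * 0)).
    apply (is_lim_seq_plus' _ _ 1 ((z + 1) * 0)); [apply is_lim_seq_const|].
    apply (is_lim_seq_scal_l (fun n => / INR n) (z + 1) 0).
    replace (Finite 0) with (Rbar_inv p_infty) by reflexivity.
    apply is_lim_seq_inv; [apply is_lim_seq_INR|discriminate]. }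
  assert (L2 := is_lim_seq_mult' _ _ _ _ L Q).
  assert (L3 : is_lim_seq (gauss_quotient (z + 1)) (recip_Gamma z * / z)).
  { apply is_lim_seq_ext_loc with (2 := L2). exists 1%nat. intros n Hn.
    assert (N : 1 <= INR n) by now apply (le_INR 1).
    unfold gauss_quotient.
    rewrite Rpower_plus, Rpower_1 by lra.
    assert (F := INR_fact_lt_0 n). assert (E := exp_pos (z * ln (INR n))).
    fold (Rpower (INR n) z) in E.
    replace (prod_f_R0 (fun k => z + 1 + INR k) n)
      with (prod_f_R0 (fun k => z + INR k) n * (z + INR n + 1) / z).
    2:{ rewrite <- P. field. lra. }
    field. repeat split; lra. }
  apply is_lim_seq_unique in L1. apply is_lim_seq_unique in L3.
  rewrite L1 in L3. injection L3. intros ->. reflexivity.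
Qed.

(** The functional equation of Gamma turns the coefficients of the Bessel series
    into those of [regular], up to the common factor [recip_Gamma (mu + 1)]. *)
Lemma BesselJ_regular alpha lambda mu x :
  1 <= alpha -> 0 < lambda -> mu = (alpha - 1) / 2 -> 0 < x ->
  BesselJ mu (x * sqrt lambda) =
    recip_Gamma (mu + 1) * Rpower (x * sqrt lambda / 2) mu * regular alpha lambda x.
Proof.
  intros Ha Hl Hmu Hx. assert (S0 := sqrt_lt_R0 _ Hl).
  unfold BesselJ, regular, PSeries. rewrite <- Series_scal_l.
  apply Series_ext. intros m.
  assert (X : 0 < x * sqrt lambda / 2) by (apply Rdiv_lt_0_compat; nra).
  rewrite Rpower_plus.
  replace (2 * INR m) with (INR (2 * m)) by (rewrite mult_INR; reflexivity).
  rewrite Rpower_pow, pow_mult by exact X.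
  replace ((x * sqrt lambda / 2) ^ 2) with (lambda / 4 * x ^ 2).
  2:{ rewrite <- (sqrt_sqrt lambda) at 1 by lra. field. }
  rewrite Rpow_mult_distr.
  assert (C : (-1) ^ m / INR (fact m) * recip_Gamma (INR m + mu + 1) * (lambda / 4) ^ m
              = recip_Gamma (mu + 1) * regular_coef alpha lambda m).
  { induction m as [|m IH].
    - simpl. rewrite Rplus_0_l. field.
    - cbn [regular_coef].
      replace (INR (S m) + mu + 1) with (INR m + mu + 1 + 1) by (rewrite S_INR; ring).
      assert (M := pos_INR m).
      rewrite recip_Gamma_succ by lra.
      rewrite fact_simpl, mult_INR, S_INR.
      assert (F := INR_fact_lt_0 m).
      replace (recip_Gamma (mu + 1) * (regular_coef alpha lambda m * (- lambda / 4)
                 / ((INR m + 1) * (INR m + (alpha + 1) / 2))))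
        with (recip_Gamma (mu + 1) * regular_coef alpha lambda m * ((- lambda / 4)
                 / ((INR m + 1) * (INR m + (alpha + 1) / 2))))
        by (field; lra).
      rewrite <- IH. simpl. subst mu. field. repeat split; lra. }
  transitivity (((-1) ^ m / INR (fact m) * recip_Gamma (INR m + mu + 1) * (lambda / 4) ^ m)
     * ((x ^ 2) ^ m * Rpower (x * sqrt lambda / 2) mu)); [ring|].
  rewrite C. ring.
Qed.

(** The Bessel inequality is [K * (phi 1 - delta * phi eta) > 0] with a
    nonnegative factor [K]; the powers of [eta] cancel. *)
Lemma regular_gap alpha lambda delta eta nu :
  1 <= alpha -> 0 < lambda -> 0 < eta -> nu = (1 - alpha) / 2 ->
  BesselJ (- nu) (sqrt lambda)
    - delta * Rpower eta nu * BesselJ (- nu) (eta * sqrt lambda) > 0 ->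
  delta * regular alpha lambda eta < regular alpha lambda 1.
Proof.
  intros Ha Hl He Hnu H.
  assert (S0 := sqrt_lt_R0 _ Hl).
  replace (BesselJ (- nu) (sqrt lambda)) with (BesselJ (- nu) (1 * sqrt lambda)) in H
    by (f_equal; ring).
  rewrite !(BesselJ_regular alpha lambda) in H by lra.
  replace (eta * sqrt lambda / 2) with (eta * (sqrt lambda / 2)) in H by field.
  replace (1 * sqrt lambda / 2) with (sqrt lambda / 2) in H by field.
  rewrite <- Rpower_mult_distr in H by lra.
  assert (E : Rpower eta nu * Rpower eta (- nu) = 1).
  { rewrite <- Rpower_plus, Rplus_opp_r. apply Rpower_O. exact He. }
  destruct (recip_Gamma_lim (- nu + 1)) as [_ G]; [lra|].
  assert (P : 0 < Rpower (sqrt lambda / 2) (- nu)) by apply exp_pos.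
  set (K := recip_Gamma (- nu + 1) * Rpower (sqrt lambda / 2) (- nu)).
  assert (HK : 0 <= K) by (apply Rmult_le_pos; lra).
  assert (H' : K * (regular alpha lambda 1 - delta * regular alpha lambda eta) > 0).
  { replace (K * _) with (K * regular alpha lambda 1
      - delta * (Rpower eta nu * Rpower eta (- nu)) * (K * regular alpha lambda eta)).
    - unfold K. lra.
    - rewrite E. ring. }
  nra.
Qed.

(** * Positivity, comparison and uniqueness *)

Lemma cont01_flux alpha y y1 y2 : 1 <= alpha -> jet y y1 y2 ->
  cont01 (fun t => weight alpha t * y1 t).
Proof.
  intros Ha H. apply cont01_mult; [now apply cont01_weight|apply (jet_cont _ _ _ H)].
Qed.

Lemma flux_noninc alpha y y1 y2 a b : 1 <= alpha -> jet y y1 y2 ->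
  0 <= a <= b -> b <= 1 -> (forall x, a < x < b -> radial_op alpha y1 y2 x <= 0) ->
  weight alpha b * y1 b <= weight alpha a * y1 a.
Proof.
  intros Ha H Hab Hb Hs.
  apply (noninc01 (fun t => weight alpha t * y1 t)
           (fun t => weight alpha t * radial_op alpha y1 y2 t)); auto.
  - now apply cont01_flux with y y2.
  - intros x Hx. apply jet_flux_derive with y; auto; lra.
  - intros x Hx. generalize (Hs x Hx) (weight_pos alpha x ltac:(lra)). intros. nra.
Qed.

Lemma flux_neg alpha y y1 y2 b : 1 <= alpha -> jet y y1 y2 ->
  0 < b <= 1 -> (forall x, 0 < x < b -> radial_op alpha y1 y2 x < 0) -> y1 b < 0.
Proof.
  intros Ha H Hb Hs.
  assert (L : weight alpha b * y1 b < weight alpha 0 * y1 0).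
  { apply (decr01 (fun t => weight alpha t * y1 t)
           (fun t => weight alpha t * radial_op alpha y1 y2 t)); auto; try lra.
    - now apply cont01_flux with y y2.
    - intros x Hx. apply jet_flux_derive with y; auto; lra.
    - intros x Hx. generalize (Hs x Hx) (weight_pos alpha x ltac:(lra)). intros. nra. }
  rewrite weight_0 in L. generalize (weight_pos alpha b ltac:(lra)). intros. nra.
Qed.

Lemma flux_nonpos alpha y y1 y2 b : 1 <= alpha -> jet y y1 y2 ->
  0 < b <= 1 -> (forall x, 0 < x < b -> radial_op alpha y1 y2 x <= 0) -> y1 b <= 0.
Proof.
  intros Ha H Hb Hs.
  generalize (flux_noninc alpha y y1 y2 0 b Ha H ltac:(lra) ltac:(lra) Hs).
  rewrite weight_0. generalize (weight_pos alpha b ltac:(lra)). intros. nra.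
Qed.

(** The flux [x^alpha w'] decreases from 0, so [w] is nonincreasing and
    [w 0 > 0]. Near 0 the decrease of the flux is strict, so [w] decreases
    strictly from there on and cannot vanish before 1; at 1 it is positive
    because it is so at [eta]. *)
Lemma supersolution_pos alpha lambda delta eta w w1 w2 a :
  1 <= alpha -> 0 < lambda -> 0 < delta -> 0 < eta < 1 -> jet w w1 w2 ->
  (forall x, I01 x -> 0 <= w x) -> I01 a -> 0 < w a ->
  (forall x, 0 < x < 1 -> radial_op alpha w1 w2 x <= - lambda * w x) ->
  w 1 >= delta * w eta ->
  forall x, I01 x -> 0 < w x.
Proof.
  intros Ha Hl Hd He H Hw Ia Hwa HL Hbc.
  assert (Cw : cont01 w) by apply (jet_cont _ _ _ H).
  assert (HL0 : forall x, 0 < x < 1 -> radial_op alpha w1 w2 x <= 0).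
  { intros x Hx. generalize (HL x Hx) (Hw x ltac:(unfold I01; lra)). intros. nra. }
  assert (N : forall s t, 0 <= s <= t -> t <= 1 -> w t <= w s).
  { intros s t Hst Ht. apply (noninc01 w w1); auto.
    - intros x Hx. apply (jet_derive _ _ _ x H). lra.
    - intros x Hx. apply (flux_nonpos alpha w w1 w2); auto; try lra.
      intros. apply HL0. lra. }
  assert (W0 : 0 < w 0).
  { apply Rlt_le_trans with (1 := Hwa). unfold I01 in Ia. apply N; lra. }
  assert (exists c, 0 < c < 1 /\ 0 < w c) as (c & Hc & Wc).
  { assert (L : locally 0 (fun t => 0 < w (clamp t))).
    { apply (Cw 0 (fun y => 0 < y)). apply (open_gt 0).
      rewrite clamp_id; [exact W0|unfold I01; lra]. }
    destruct L as [d L].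
    assert (Hd2 : 0 < Rmin d 1) by (apply Rmin_glb_lt; [apply cond_pos|lra]).
    assert (B := Rmin_l d 1). assert (B' := Rmin_r d 1).
    exists (Rmin d 1 / 2). split; [lra|].
    rewrite <- (clamp_id (Rmin d 1 / 2)) by (unfold I01; lra). apply L.
    unfold ball; simpl. unfold AbsRing_ball, abs, minus, plus, opp; simpl.
    rewrite Ropp_0, Rplus_0_r, Rabs_pos_eq; lra. }
  assert (D : w1 c < 0).
  { apply (flux_neg alpha w w1 w2); auto; try lra.
    intros x Hx. generalize (HL x ltac:(lra)) (N x c ltac:(lra) ltac:(lra)). intros. nra. }
  assert (P : forall x, 0 <= x < 1 -> 0 < w x).
  { intros x Hx. destruct (Rle_dec x c) as [h|h].
    - apply Rlt_le_trans with (1 := Wc). apply N; lra.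
    - apply Rle_lt_trans with (w 1); [apply Hw; unfold I01; lra|].
      apply (decr01 w w1); auto; try lra.
      + intros t Ht. apply (jet_derive _ _ _ t H). lra.
      + intros t Ht.
        generalize (flux_noninc alpha w w1 w2 c t Ha H ltac:(lra) ltac:(lra)
          ltac:(intros; apply HL0; lra)).
        generalize (weight_pos alpha t ltac:(lra)) (weight_pos alpha c ltac:(lra)).
        intros. nra. }
  intros x Hx. destruct (Req_dec x 1) as [->|n].
  - generalize (P eta ltac:(lra)). intros. nra.
  - apply P. unfold I01 in Hx. lra.
Qed.

(** The point is the supremum of the [x] such that [g > 0] on [[0,x]]. *)
Lemma first_nonpos g b : (forall x, continuous g x) -> 0 < g 0 -> 0 <= b -> g b <= 0 ->
  exists m, 0 < m <= b /\ g m <= 0 /\ forall t, 0 <= t < m -> 0 < g t.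
Proof.
  intros Cg G0 Hb Gb.
  set (E := fun x => 0 <= x <= b /\ forall t, 0 <= t <= x -> 0 < g t).
  destruct (completeness E) as [m [U L]].
  - exists b. intros x [Hx _]. lra.
  - exists 0. split; [lra|]. intros t Ht. now replace t with 0 by lra.
  - assert (m <= b) by (apply L; intros x [Hx _]; lra).
    assert (0 <= m).
    { apply U. split; [lra|]. intros t Ht. now replace t with 0 by lra. }
    assert (P : forall t, 0 <= t < m -> 0 < g t).
    { intros t Ht. destruct (Rlt_dec 0 (g t)) as [h|h]; [exact h|exfalso].
      assert (m <= t); [|lra]. apply L. intros x [Hx Hx'].
      destruct (Rle_dec x t) as [h'|h']; [exact h'|]. exfalso. apply h, Hx'. lra. }
    assert (G : g m <= 0).
    { destruct (Rle_dec (g m) 0) as [h|h]; [exact h|exfalso].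
      destruct (Cg m (fun y => 0 < y)) as [d D].
      { apply (open_gt 0). lra. }
      assert (m <> b) by (intros ->; lra).
      assert (Hm : 0 < Rmin (d / 2) (b - m)).
      { apply Rmin_glb_lt; [generalize (cond_pos d)|]; lra. }
      assert (B := Rmin_l (d / 2) (b - m)). assert (B' := Rmin_r (d / 2) (b - m)).
      assert (m + Rmin (d / 2) (b - m) <= m); [|lra].
      apply U. split; [lra|]. intros t Ht.
      destruct (Rlt_dec t m) as [h'|h']; [apply P; lra|].
      apply D. unfold ball; simpl. unfold AbsRing_ball, abs, minus, plus, opp; simpl.
      rewrite Rabs_pos_eq; lra. }
    exists m. repeat split; auto. destruct (Req_dec m 0) as [->|n]; lra.
Qed.

(** The function [x^alpha (phi y' - phi' y)] vanishes at 0 and has derivative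
    [x^alpha phi (L y + lambda y) <= 0]. *)
Lemma wronskian_nonpos alpha lambda y y1 y2 b :
  1 <= alpha -> 0 < lambda -> jet y y1 y2 -> 0 < b <= 1 ->
  (forall x, 0 < x < b -> 0 <= regular alpha lambda x) ->
  (forall x, 0 < x < b -> radial_op alpha y1 y2 x + lambda * y x <= 0) ->
  regular alpha lambda b * y1 b - regular1 alpha lambda b * y b <= 0.
Proof.
  intros Ha Hl H Hb Hp HL.
  assert (Hr := regular_jet alpha lambda Ha Hl).
  set (p := regular alpha lambda) in *. set (p1 := regular1 alpha lambda) in *.
  (* Written with the fluxes, whose derivatives are known at all interior points. *)
  set (W := fun x => p x * (weight alpha x * y1 x) - y x * (weight alpha x * p1 x)).
  assert (L : W b <= W 0).
  { apply (noninc01 W (fun x => weight alpha x * (p x * (radial_op alpha y1 y2 x + lambda * y x))));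
      try lra.
    - apply cont01_minus; apply cont01_mult.
      + apply (jet_cont _ _ _ Hr).
      + now apply cont01_flux with y y2.
      + apply (jet_cont _ _ _ H).
      + now apply (cont01_flux alpha _ _ _ Ha Hr).
    - intros x Hx.
      destruct (jet_derive _ _ _ x H ltac:(lra)) as [Dy _].
      destruct (jet_derive _ _ _ x Hr ltac:(lra)) as [Dp _].
      evar_last.
      + apply (is_derive_minus (fun x => p x * (weight alpha x * y1 x))
                 (fun x => y x * (weight alpha x * p1 x))).
        * apply (Derive.is_derive_mult p); [exact Dp|].
          apply (jet_flux_derive alpha _ _ _ x H). lra.
        * apply (Derive.is_derive_mult y); [exact Dy|].
          apply (jet_flux_derive alpha _ _ _ x Hr). lra.
      + generalize (regular_ode alpha lambda Ha Hl x ltac:(lra)). fold p p1. intros ->.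
        unfold minus, plus, opp; simpl. ring.
    - intros x Hx. generalize (Hp x Hx) (HL x Hx) (weight_pos alpha x ltac:(lra)). intros.
      assert (p x * (radial_op alpha y1 y2 x + lambda * y x) <= 0) by nra. nra. }
  unfold W in L. rewrite weight_0 in L.
  generalize (weight_pos alpha b ltac:(lra)). intros. nra.
Qed.

(** At a first zero [m] of [phi] one has [phi' m < 0], because the flux of [phi]
    decreases strictly before [m]. Then [- phi' m * w m > 0] contradicts the
    sign of the Wronskian. *)
Lemma regular_pos alpha lambda delta eta w w1 w2 a :
  1 <= alpha -> 0 < lambda -> 0 < delta -> 0 < eta < 1 -> jet w w1 w2 ->
  (forall x, I01 x -> 0 <= w x) -> I01 a -> 0 < w a ->
  (forall x, 0 < x < 1 -> radial_op alpha w1 w2 x <= - lambda * w x) ->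
  w 1 >= delta * w eta ->
  forall x, I01 x -> 0 < regular alpha lambda x.
Proof.
  intros Ha Hl Hd He H Hw Ia Hwa HL Hbc x Hx.
  assert (P := supersolution_pos _ _ _ _ _ _ _ _ Ha Hl Hd He H Hw Ia Hwa HL Hbc).
  destruct (Rlt_dec 0 (regular alpha lambda x)) as [h|h]; [exact h|exfalso].
  unfold I01 in Hx.
  destruct (first_nonpos (regular alpha lambda) x) as (m & Hm & Gm & Pm).
  - intros t. apply (ex_derive_continuous (regular alpha lambda)).
    eexists. now apply is_derive_regular.
  - rewrite regular_at_0. lra.
  - lra.
  - lra.
  - assert (D : regular1 alpha lambda m < 0).
    { apply (flux_neg alpha _ _ _ m Ha (regular_jet alpha lambda Ha Hl)); [lra|].
      intros t Ht. rewrite regular_ode by lra. generalize (Pm t ltac:(lra)). intros. nra. }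
    assert (Wm : w1 m <= 0).
    { apply (flux_nonpos alpha w w1 w2); auto; try lra. intros t Ht.
      generalize (HL t ltac:(lra)) (Hw t ltac:(unfold I01; lra)). intros. nra. }
    assert (Q := wronskian_nonpos alpha lambda w w1 w2 m Ha Hl H ltac:(lra)
      ltac:(intros; apply Rlt_le, Pm; lra)
      ltac:(intros t Ht; generalize (HL t ltac:(lra)); lra)).
    generalize (P m ltac:(unfold I01; lra)). intros. nra.
Qed.

Lemma cont01_div g h : cont01 g -> cont01 h -> (forall x, I01 x -> h x <> 0) ->
  cont01 (fun x => g x / h x).
Proof.
  intros G H N. apply cont01_mult; auto. intros x.
  apply (continuous_comp (fun t => h (clamp t)) Rinv); [apply H|].
  apply continuous_Rinv. apply N, clamp_I01.
Qed.

(** By the sign of the Wronskian the quotient [z = y / phi] is nonincreasing. If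
    [z 1] were negative, then [phi 1 * z 1 < delta * phi eta * z 1 <= delta *
    phi eta * z eta], against the boundary inequality. *)
Lemma maximum_principle alpha lambda delta eta y y1 y2 :
  1 <= alpha -> 0 < lambda -> 0 < delta -> 0 < eta < 1 ->
  (forall x, I01 x -> 0 < regular alpha lambda x) ->
  delta * regular alpha lambda eta < regular alpha lambda 1 ->
  jet y y1 y2 ->
  (forall x, 0 < x < 1 -> radial_op alpha y1 y2 x + lambda * y x <= 0) ->
  y 1 >= delta * y eta ->
  forall x, I01 x -> 0 <= y x.
Proof.
  intros Ha Hl Hd He Hp Hgap H HL Hbc.
  assert (Hr := regular_jet alpha lambda Ha Hl).
  set (p := regular alpha lambda) in *.
  set (z := fun x => y x / p x).
  assert (Y : forall x, I01 x -> y x = p x * z x).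
  { intros x Hx. unfold z. field. apply Rgt_not_eq, Hp, Hx. }
  assert (N : forall x, I01 x -> z 1 <= z x).
  { intros x Hx. unfold I01 in Hx.
    apply (noninc01 z (fun t => (y1 t * p t - y t * regular1 alpha lambda t) / p t ^ 2)); try lra.
    - apply cont01_div; [apply (jet_cont _ _ _ H)|apply (jet_cont _ _ _ Hr)|].
      intros t Ht. apply Rgt_not_eq, Hp, Ht.
    - intros t Ht. apply is_derive_div.
      + apply (jet_derive _ _ _ t H). lra.
      + apply (jet_derive _ _ _ t Hr). lra.
      + apply Rgt_not_eq, Hp. unfold I01; lra.
    - intros t Ht.
      assert (Q := wronskian_nonpos alpha lambda y y1 y2 t Ha Hl H ltac:(lra)
        ltac:(intros; apply Rlt_le, Hp; unfold I01; lra)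
        ltac:(intros; apply HL; lra)).
      fold p in Q.
      assert (0 < / p t ^ 2).
      { apply Rinv_0_lt_compat, pow_lt, Hp. unfold I01; lra. }
      unfold Rdiv. nra. }
  assert (I1 : I01 1) by (unfold I01; lra). assert (Ie : I01 eta) by (unfold I01; lra).
  assert (Z1 : 0 <= z 1).
  { rewrite (Y 1 I1), (Y eta Ie) in Hbc.
    generalize (N eta Ie) (Hp 1 I1) (Hp eta Ie). intros n p1 pe.
    destruct (Rle_dec 0 (z 1)) as [h|h]; [exact h|exfalso].
    assert (delta * p eta * z 1 <= delta * p eta * z eta).
    { apply Rmult_le_compat_l; [|exact n]. apply Rmult_le_pos; lra. }
    assert (p 1 * z 1 < delta * p eta * z 1) by nra. lra. }
  intros x Hx. rewrite (Y x Hx). generalize (N x Hx) (Hp x Hx). intros. nra.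
Qed.

(** The energy [d'^2 + lambda d^2] has derivative [- 2 (alpha/x) d'^2 <= 0] and
    starts from 0. Unlike an argument with [d / phi], this is valid whatever the
    sign of [phi]. *)
Lemma energy_uniqueness alpha lambda d d1 d2 :
  1 <= alpha -> 0 < lambda -> jet d d1 d2 -> d 0 = 0 -> d1 0 = 0 ->
  (forall x, 0 < x < 1 -> radial_op alpha d1 d2 x + lambda * d x = 0) ->
  forall x, I01 x -> d x = 0.
Proof.
  intros Ha Hl H D0 D1 HL x Hx. unfold I01 in Hx.
  destruct (jet_cont _ _ _ H) as (C & C1 & _).
  assert (L : d1 x * d1 x + lambda * (d x * d x) <= d1 0 * d1 0 + lambda * (d 0 * d 0)).
  { apply (noninc01 (fun t => d1 t * d1 t + lambda * (d t * d t))
            (fun t => 2 * d1 t * (d2 t + lambda * d t))); try lra.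
    - apply cont01_plus; [|apply cont01_scal]; now apply cont01_mult.
    - intros t Ht. destruct (jet_derive _ _ _ t H ltac:(lra)) as [E E1].
      evar_last.
      + apply (is_derive_plus (fun t => d1 t * d1 t) (fun t => lambda * (d t * d t))).
        * apply (Derive.is_derive_mult d1 d1); exact E1.
        * apply is_derive_scal. apply (Derive.is_derive_mult d d); exact E.
      + unfold plus; simpl. ring.
    - intros t Ht. generalize (HL t ltac:(lra)). unfold radial_op. intros E.
      replace (d2 t + lambda * d t) with (- (alpha / t) * d1 t) by lra.
      assert (0 < alpha / t) by (apply Rdiv_lt_0_compat; lra).
      assert (0 <= d1 t * d1 t) by nra. nra. }
  rewrite D0, D1 in L.
  assert (0 <= d1 x * d1 x) by nra.
  assert (Q : d x * d x = 0) by nra. now apply Rmult_integral in Q as [|].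
Qed.

(** By the energy argument [d = d 0 * phi], and then the boundary condition
    reads [d 0 * (phi 1 - delta * phi eta) = 0]. *)
Lemma three_point_uniqueness alpha lambda delta eta d d1 d2 :
  1 <= alpha -> 0 < lambda -> 0 < eta < 1 ->
  delta * regular alpha lambda eta < regular alpha lambda 1 ->
  jet d d1 d2 -> d1 0 = 0 -> d 1 = delta * d eta ->
  (forall x, 0 < x < 1 -> radial_op alpha d1 d2 x + lambda * d x = 0) ->
  forall x, I01 x -> d x = 0.
Proof.
  intros Ha Hl He Hgap H D1 Hbc HL.
  assert (Hr := regular_jet alpha lambda Ha Hl).
  assert (E : forall x, I01 x -> 1 * d x + - d 0 * regular alpha lambda x = 0).
  { apply (energy_uniqueness alpha lambda _ _ _ Ha Hl (jet_lin 1 (- d 0) _ _ _ _ _ _ H Hr)).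
    - rewrite regular_at_0. ring.
    - rewrite D1, regular1_at_0. ring.
    - intros x Hx. generalize (HL x Hx) (regular_ode alpha lambda Ha Hl x ltac:(lra)).
      unfold radial_op. intros E E'.
      transitivity (d2 x + alpha / x * d1 x + lambda * d x
        - d 0 * (regular2 alpha lambda x + alpha / x * regular1 alpha lambda x
                 + lambda * regular alpha lambda x)); [ring|].
      rewrite E, E'. ring. }
  assert (Z : d 0 = 0).
  { generalize (E 1 ltac:(unfold I01; lra)) (E eta ltac:(unfold I01; lra)). intros. nra. }
  intros x Hx. generalize (E x Hx). rewrite Z. lra.
Qed.

(** * Solvability of the linear three-point problem *)

Lemma is_derive_primitive (g : R -> R) (x : R) : (forall t, continuous g t) ->
  is_derive (fun b => RInt g 0 b) x (g x).
Proof.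
  intros H. apply (is_derive_RInt g (fun b => RInt g 0 b) 0 x); [|apply H].
  apply filter_forall. intros b. apply (RInt_correct g). apply ex_RInt_continuous. auto.
Qed.

Definition weighted_primitive (alpha : R) (k : R -> R) (x : R) : R :=
  RInt (fun t => weight alpha t * k t) 0 x.

(** The function [x^(-alpha-1) * int_0^x t^alpha k(t) dt], extended to [x <= 0]
    by its limit at 0. If [x^alpha y'] has derivative [x^alpha k] and vanishes
    at 0, then [y' = x * weighted_mean], so the behaviour of this mean at 0
    decides whether [y] is twice continuously differentiable there. *)
Definition weighted_mean (alpha : R) (k : R -> R) (x : R) : R :=
  if Rlt_dec 0 x then weighted_primitive alpha k x / (x * weight alpha x)
  else k 0 / (alpha + 1).

Section Mean.
Variables (alpha : R) (k : R -> R).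
Hypothesis Ha : 1 <= alpha.
Hypothesis Ck : forall x, continuous k x.
Let F := weighted_primitive alpha k.
Let r := weighted_mean alpha k.

Lemma is_derive_weighted_primitive x : is_derive F x (weight alpha x * k x).
Proof.
  apply (is_derive_primitive (fun t => weight alpha t * k t)). intros t.
  apply (continuous_mult (weight alpha) k); [now apply continuous_weight|apply Ck].
Qed.

Lemma is_derive_id_weight x : 0 < x ->
  is_derive (fun t => t * weight alpha t) x ((alpha + 1) * weight alpha x).
Proof.
  intros Hx. evar_last.
  - apply (Derive.is_derive_mult (fun t => t) (weight alpha));
      [apply @is_derive_id|now apply is_derive_weight].
  - unfold one; simpl. field. lra.
Qed.

(** One statement for the upper bound ([s = 1]) and the lower bound ([s = -1]):
    [c t^(alpha+1) / (alpha+1)] is the integral of [c t^alpha]. *)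
Lemma weighted_primitive_bound s c t : 0 < t <= 1 ->
  (forall x, 0 < x < t -> s * k x <= c) -> s * F t <= c / (alpha + 1) * (t * weight alpha t).
Proof.
  intros Ht B.
  assert (L : s * F t - c / (alpha + 1) * (t * weight alpha t)
              <= s * F 0 - c / (alpha + 1) * (0 * weight alpha 0)).
  { apply (noninc01 (fun x => s * F x - c / (alpha + 1) * (x * weight alpha x))
       (fun x => weight alpha x * (s * k x - c))); try lra.
    - apply cont01_of_continuous. intros x _.
      apply (continuous_minus (fun x => s * F x) (fun x => c / (alpha + 1) * (x * weight alpha x))).
      + apply (continuous_mult (fun _ => s) F); [apply continuous_const|].
        apply (ex_derive_continuous F). eexists. apply is_derive_weighted_primitive.
      + apply (continuous_mult (fun _ => c / (alpha + 1)) (fun x => x * weight alpha x));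
          [apply continuous_const|].
        apply (continuous_mult (fun x => x) (weight alpha));
          [apply continuous_id|now apply continuous_weight].
    - intros x Hx. evar_last.
      + apply (is_derive_minus (fun x => s * F x)
          (fun x => c / (alpha + 1) * (x * weight alpha x))).
        * apply is_derive_scal, is_derive_weighted_primitive.
        * apply is_derive_scal, is_derive_id_weight. lra.
      + unfold minus, plus, opp; simpl. field. lra.
    - intros x Hx. generalize (B x Hx) (weight_pos alpha x ltac:(lra)). intros. nra. }
  replace (F 0) with 0 in L; [lra|].
  symmetry. apply (RInt_point 0 (fun t => weight alpha t * k t)).
Qed.

Lemma weighted_mean_near_0 : filterlim r (locally 0) (locally (r 0)).
Proof.
  apply filterlim_locally. intros eps.
  destruct (proj1 (filterlim_locally _ _) (Ck 0) eps) as [d D].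
  assert (Hd : 0 < Rmin d 1) by (apply Rmin_glb_lt; [apply cond_pos|lra]).
  exists (mkposreal _ Hd). intros t Ht.
  assert (B := Rmin_l d 1). assert (B' := Rmin_r d 1).
  change (Rabs (t - 0) < Rmin d 1) in Ht. rewrite Rminus_0_r in Ht.
  change (Rabs (r t - r 0) < eps). unfold r, weighted_mean at 2.
  destruct (Rlt_dec 0 0) as [h|_]; [lra|]. unfold weighted_mean.
  destruct (Rlt_dec 0 t) as [h|h].
  2:{ unfold Rminus. rewrite Rplus_opp_r, Rabs_R0. apply cond_pos. }
  rewrite Rabs_pos_eq in Ht by lra.
  assert (K : forall x, 0 < x < t -> - eps < k x - k 0 < eps).
  { intros x Hx. assert (Q : Rabs (k x - k 0) < eps).
    - apply D. change (Rabs (x - 0) < d). rewrite Rminus_0_r, Rabs_pos_eq; lra.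
    - apply Rabs_def2 in Q. lra. }
  assert (U := weighted_primitive_bound 1 (k 0 + eps) t ltac:(lra)
    ltac:(intros x Hx; generalize (K x Hx); lra)).
  assert (L := weighted_primitive_bound (-1) (- k 0 + eps) t ltac:(lra)
    ltac:(intros x Hx; generalize (K x Hx); lra)).
  fold F. assert (W : 0 < t * weight alpha t) by (generalize (weight_pos alpha t h); nra).
  set (T := t * weight alpha t) in *.
  assert (Heps : eps / (alpha + 1) < eps).
  { apply Rmult_lt_reg_r with (alpha + 1); [lra|]. unfold Rdiv.
    rewrite Rmult_assoc, Rinv_l by lra. generalize (cond_pos eps). nra. }
  apply Rle_lt_trans with (2 := Heps).
  replace (F t / T - k 0 / (alpha + 1)) with ((F t - k 0 / (alpha + 1) * T) * / T) by (field; lra).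
  rewrite Rabs_mult, (Rabs_pos_eq (/ T)) by (left; now apply Rinv_0_lt_compat).
  apply Rmult_le_reg_r with T; [exact W|]. rewrite Rmult_assoc, Rinv_l, Rmult_1_r by lra.
  apply Rabs_le. unfold Rdiv in *. lra.
Qed.

Lemma continuous_weighted_mean x : continuous r x.
Proof.
  destruct (Rlt_dec 0 x) as [h|h].
  - apply continuous_ext_loc with (fun t => F t / (t * weight alpha t)).
    + apply (filter_imp (fun t => 0 < t)); [|now apply (open_gt 0)].
      intros t Ht. unfold r, weighted_mean. now destruct (Rlt_dec 0 t).
    + apply (ex_derive_continuous (fun t => F t / (t * weight alpha t))).
      eexists. apply is_derive_div; [apply is_derive_weighted_primitive|now apply is_derive_id_weight|].
      generalize (weight_pos alpha x h). nra.
  - destruct (Req_dec x 0) as [->|n]; [apply weighted_mean_near_0|].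
    apply continuous_ext_loc with (fun _ => k 0 / (alpha + 1)); [|apply continuous_const].
    apply (filter_imp (fun t => t < 0)); [|apply (open_lt 0); lra].
    intros t Ht. unfold r, weighted_mean. destruct (Rlt_dec 0 t); lra.
Qed.

(** For [x > 0] the function is [F / x^alpha] with [F' = x^alpha k]. At 0 its
    slope is the limit of the mean, [k 0 / (alpha+1)], which also equals
    [k 0 - alpha * k 0 / (alpha+1)]. *)
Lemma is_derive_id_weighted_mean x : 0 <= x ->
  is_derive (fun t => t * r t) x (k x - alpha * r x).
Proof.
  intros Hx. destruct (Req_dec x 0) as [->|n].
  - replace (k 0 - alpha * r 0) with (r 0).
    2:{ unfold r, weighted_mean. destruct (Rlt_dec 0 0); [lra|]. field. lra. }
    apply is_derive_Reals. intros eps Heps.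
    destruct (proj1 (filterlim_locally _ _) (continuous_weighted_mean 0) (mkposreal eps Heps)) as [d D].
    exists d. intros h Hh Hh'.
    replace (((0 + h) * r (0 + h) - 0 * r 0) / h) with (r h).
    2:{ rewrite Rplus_0_l. field. exact Hh. }
    apply (D h). change (Rabs (h - 0) < d). now rewrite Rminus_0_r.
  - assert (h : 0 < x) by lra. assert (W := weight_pos alpha x h).
    apply is_derive_ext_loc with (fun t => F t / weight alpha t).
    + apply (filter_imp (fun t => 0 < t)); [|now apply (open_gt 0)].
      intros t Ht. change (F t / weight alpha t = t * r t :> R).
      unfold r, weighted_mean. destruct (Rlt_dec 0 t); [|lra].
      fold F. generalize (weight_pos alpha t Ht). intros. field. lra.
    + evar_last.
      * apply is_derive_div; [apply is_derive_weighted_primitive|now apply is_derive_weight|lra].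
      * unfold r, weighted_mean. destruct (Rlt_dec 0 x); [|lra]. fold F. field. lra.
Qed.
End Mean.

(** Reduction of order: [y = phi * (c - Z)] with [Z' = x^(-alpha) phi^(-2)
    int_0^x t^alpha phi h]. The constant [c] is determined by the boundary
    condition, because [phi 1 <> delta * phi eta]. *)
Lemma linear_bvp_solvable alpha lambda delta eta h :
  1 <= alpha -> 0 < lambda -> 0 < eta < 1 ->
  (forall x, I01 x -> 0 < regular alpha lambda x) ->
  delta * regular alpha lambda eta < regular alpha lambda 1 ->
  cont01 h ->
  exists y y1 y2, jet y y1 y2 /\ y1 0 = 0 /\ y 1 = delta * y eta /\
    forall x, 0 < x < 1 -> radial_op alpha y1 y2 x + lambda * y x = - h x.
Proof.
  intros Ha Hl He Hp Hgap Ch.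
  assert (Hr := regular_jet alpha lambda Ha Hl).
  assert (Hp1 := regular1_at_0 alpha lambda).
  assert (Hode := regular_ode alpha lambda Ha Hl).
  assert (Dp := is_derive_regular alpha lambda Ha Hl).
  assert (Dp1 := is_derive_regular1 alpha lambda Ha Hl).
  set (p := regular alpha lambda) in *. set (p1 := regular1 alpha lambda) in *.
  set (p2 := regular2 alpha lambda) in *.
  assert (Cp : cont01 p) by apply (jet_cont _ _ _ Hr).
  assert (Cp2 : cont01 p2) by apply (jet_cont _ _ _ Hr).
  set (k := fun t => p (clamp t) * h (clamp t)).
  assert (Ck : forall x, continuous k x).
  { intros x. apply (continuous_mult (fun t => p (clamp t)) (fun t => h (clamp t)));
      [apply Cp|apply Ch]. }
  set (r := weighted_mean alpha k).
  assert (Cr := continuous_weighted_mean alpha k Ha Ck). fold r in Cr.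
  assert (Dq := is_derive_id_weighted_mean alpha k Ha Ck). fold r in Dq.
  (* The projection keeps the denominator away from 0 off [0,1], so that [g] has
     a primitive on the whole line. *)
  set (g := fun t => t * r t / p (clamp t) ^ 2).
  assert (N : forall x, I01 x -> p x <> 0) by (intros x Hx; apply Rgt_not_eq, Hp, Hx).
  assert (Cg : forall t, continuous g t).
  { intros t. apply (continuous_mult (fun t => t * r t) (fun t => / p (clamp t) ^ 2)).
    - apply (continuous_mult (fun t => t) r); [apply continuous_id|apply Cr].
    - apply (continuous_comp (fun t => p (clamp t) ^ 2) Rinv).
      + apply (continuous_mult (fun t => p (clamp t)) (fun t => p (clamp t) * 1)); [apply Cp|].
        apply (continuous_mult (fun t => p (clamp t)) (fun _ => 1)); [apply Cp|apply continuous_const].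
      + apply continuous_Rinv. apply pow_nonzero, N, clamp_I01. }
  set (Z := fun b => RInt g 0 b).
  assert (DZ : forall x, is_derive Z x (g x)) by (intros; now apply is_derive_primitive).
  set (c := (p 1 * Z 1 - delta * p eta * Z eta) / (p 1 - delta * p eta)).
  assert (Gx : forall x, I01 x -> g x = x * r x / p x ^ 2).
  { intros x Hx. unfold g. now rewrite clamp_id. }
  assert (DcZ : forall x, is_derive (fun x => c - Z x) x (- g x)).
  { intros x. evar_last.
    - apply (is_derive_minus (fun _ => c) Z); [apply @is_derive_const|apply DZ].
    - unfold minus, plus, opp, zero; simpl. ring. }
  exists (fun x => p x * (c - Z x)), (fun x => p1 x * (c - Z x) - x * r x / p x),
    (fun x => p2 x * (c - Z x) - (k x - alpha * r x) / p x).
  repeat split.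
  - intros x Hx. apply is_derive_D_in. evar_last.
    + apply (Derive.is_derive_mult p (fun x => c - Z x)); [apply Dp|apply DcZ].
    + rewrite Gx by assumption. fold p1. generalize (N x Hx). intros. field. assumption.
  - intros x Hx. apply is_derive_D_in. evar_last.
    + apply (is_derive_minus (fun x => p1 x * (c - Z x)) (fun x => x * r x / p x)).
      * apply (Derive.is_derive_mult p1 (fun x => c - Z x)); [apply Dp1|apply DcZ].
      * apply is_derive_div; [apply Dq; unfold I01 in Hx; lra|apply Dp|now apply N].
    + rewrite Gx by assumption. fold p1 p2. unfold minus, plus, opp; simpl.
      generalize (N x Hx). intros. field. assumption.
  - apply continuous_on_cont01. apply cont01_minus.
    + apply cont01_mult; [exact Cp2|]. apply cont01_of_continuous. intros x _.
      apply (ex_derive_continuous (fun x => c - Z x)). eexists. apply DcZ.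
    + apply cont01_div; auto. apply cont01_of_continuous. intros x _.
      apply (continuous_minus k (fun x => alpha * r x)); [apply Ck|].
      apply (continuous_mult (fun _ => alpha) r); [apply continuous_const|apply Cr].
  - simpl. rewrite Hp1. unfold Rdiv. ring.
  - simpl. unfold c. field. lra.
  - intros x Hx. assert (Ix : I01 x) by (unfold I01; lra).
    generalize (Hode x ltac:(lra)). unfold radial_op. fold p1 p2. intros E.
    unfold k. rewrite (clamp_id x Ix). generalize (N x Ix). intros Nx.
    transitivity ((p2 x + alpha / x * p1 x) * (c - Z x) + lambda * (p x * (c - Z x)) - h x).
    + field. lra.
    + rewrite E. ring.
Qed.

(** * The boundary value problem and the iteration in terms of jets *)

Lemma jet_ext y z y1 y2 : (forall x, I01 x -> y x = z x) -> jet y y1 y2 -> jet z y1 y2.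
Proof.
  intros E (H & H' & C). repeat split; auto.
  intros x Hx eps Heps. destruct (H x Hx eps Heps) as [d [Hd D]].
  exists d. split; auto. intros t Ht. rewrite <- !E; auto. apply (proj1 (proj1 Ht)).
Qed.

Lemma next_iterate_jet alpha delta eta lambda f y z :
  next_iterate alpha delta eta lambda f y z <->
  exists z1 z2, jet z z1 z2 /\ z1 0 = 0 /\ z 1 = delta * z eta /\
    forall x, 0 < x < 1 ->
      radial_op alpha z1 z2 x + lambda * z x = - (f x (y x) - lambda * y x).
Proof.
  assert (R : forall z1 z2 x, jet z z1 z2 -> 0 < x < 1 ->
    - Derive_n z 2 x - alpha / x * Derive z x - lambda * z x
    = - (radial_op alpha z1 z2 x + lambda * z x)).
  { intros z1 z2 x J Hx. rewrite (jet_Derive_n2 _ _ _ x J Hx).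
    rewrite (is_derive_unique z x (z1 x)) by (apply (jet_derive _ _ _ x J Hx)).
    unfold radial_op. ring. }
  split.
  - intros ((z1 & z2 & J) & E & Z & B). exists z1, z2. repeat split; try apply J; auto.
    + now apply (zero_slope_jet z z1 z2).
    + intros x Hx. generalize (R z1 z2 x J Hx) (E x Hx). lra.
  - intros (z1 & z2 & J & Z & B & E). split; [|split; [|split]]; auto.
    + now exists z1, z2.
    + intros x Hx. rewrite (R z1 z2 x J Hx), E by assumption. ring.
    + now apply (zero_slope_jet z z1 z2).
Qed.

(** For [0 < x < 1] the positive factor [x^alpha] cancels from the differential
    inequalities. *)
Lemma SL_op_compare alpha y y1 y2 x c : jet y y1 y2 -> 0 < x < 1 ->
  (SL_op alpha y x <= Rpower x alpha * c <-> - c <= radial_op alpha y1 y2 x) /\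
  (SL_op alpha y x >= Rpower x alpha * c <-> radial_op alpha y1 y2 x <= - c).
Proof.
  intros J Hx. rewrite (SL_op_radial alpha y y1 y2 x J Hx).
  assert (P : 0 < Rpower x alpha) by apply exp_pos.
  split; split; intros; nra.
Qed.

Lemma upper_solution_jet alpha delta eta f u : upper_solution alpha delta eta f u ->
  exists u1 u2, jet u u1 u2 /\ u1 0 = 0 /\ u 1 >= delta * u eta /\
    forall x, 0 < x < 1 -> radial_op alpha u1 u2 x <= - f x (u x).
Proof.
  intros ((u1 & u2 & J) & E & Z & B). exists u1, u2. repeat split; try apply J; auto.
  - now apply (zero_slope_jet u u1 u2).
  - intros x Hx. apply (SL_op_compare alpha u u1 u2 x (f x (u x)) J Hx). now apply E.
Qed.

Lemma lower_solution_jet alpha delta eta f v : lower_solution alpha delta eta f v ->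
  exists v1 v2, jet v v1 v2 /\ v1 0 = 0 /\ v 1 <= delta * v eta /\
    forall x, 0 < x < 1 -> - f x (v x) <= radial_op alpha v1 v2 x.
Proof.
  intros ((v1 & v2 & J) & E & Z & B). exists v1, v2. repeat split; try apply J; auto.
  - now apply (zero_slope_jet v v1 v2).
  - intros x Hx. apply (SL_op_compare alpha v v1 v2 x (f x (v x)) J Hx). now apply E.
Qed.

Lemma bvp_solution_jet alpha delta eta f y :
  bvp_solution alpha delta eta f y <->
  exists y1 y2, jet y y1 y2 /\ y1 0 = 0 /\ y 1 = delta * y eta /\
    forall x, 0 < x < 1 -> radial_op alpha y1 y2 x = - f x (y x).
Proof.
  split.
  - intros ((y1 & y2 & J) & E & Z & B). exists y1, y2. repeat split; try apply J; auto.
    + now apply (zero_slope_jet y y1 y2).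
    + intros x Hx. destruct (SL_op_compare alpha y y1 y2 x (f x (y x)) J Hx) as [L U].
      generalize (E x Hx). intros Ex.
      apply Rle_antisym; [apply U|apply L]; rewrite Ex; lra.
  - intros (y1 & y2 & J & Z & B & E). split; [|split; [|split]]; auto.
    + now exists y1, y2.
    + intros x Hx. rewrite (SL_op_radial alpha y y1 y2 x J Hx), E by assumption. ring.
    + now apply (zero_slope_jet y y1 y2).
Qed.

(** The terms [lambda * y] on both sides of the scheme cancel when the iterate
    reproduces itself. *)
Lemma bvp_solution_fixpoint alpha delta eta lambda f y :
  bvp_solution alpha delta eta f y <-> next_iterate alpha delta eta lambda f y y.
Proof.
  rewrite bvp_solution_jet, next_iterate_jet.
  split; intros (y1 & y2 & J & Z & B & E); exists y1, y2; repeat split; try apply J; auto;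
    intros x Hx; generalize (E x Hx); lra.
Qed.

Lemma next_iterate_ext alpha delta eta lambda f y y' z :
  (forall x, I01 x -> y x = y' x) ->
  next_iterate alpha delta eta lambda f y z ->
  next_iterate alpha delta eta lambda f y' z.
Proof.
  intros E (A & B & C). split; [exact A|]. split; [|exact C].
  intros x Hx. rewrite <- E by (unfold I01; lra). now apply B.
Qed.

Lemma next_iterate_unique alpha delta eta lambda f y y' z z' :
  1 <= alpha -> 0 < lambda -> 0 < eta < 1 ->
  delta * regular alpha lambda eta < regular alpha lambda 1 ->
  (forall x, I01 x -> y x = y' x) ->
  next_iterate alpha delta eta lambda f y z ->
  next_iterate alpha delta eta lambda f y' z' ->
  forall x, I01 x -> z x = z' x.
Proof.
  intros Ha Hl He Hgap E H H' x Hx.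
  apply next_iterate_jet in H as (z1 & z2 & J & Z & B & Eq).
  apply next_iterate_jet in H' as (z1' & z2' & J' & Z' & B' & Eq').
  generalize (three_point_uniqueness alpha lambda delta eta _ _ _ Ha Hl He Hgap
    (jet_lin 1 (-1) _ _ _ _ _ _ J J') ltac:(lra) ltac:(lra)).
  intros U. enough (1 * z x + -1 * z' x = 0) by lra. apply U; [|exact Hx].
  intros t Ht. generalize (Eq t Ht) (Eq' t Ht). rewrite <- (E t) by (unfold I01; lra).
  unfold radial_op. lra.
Qed.

Lemma iteration_generated alpha delta eta lambda f y0 s :
  1 <= alpha -> 0 < lambda -> 0 < eta < 1 ->
  delta * regular alpha lambda eta < regular alpha lambda 1 ->
  iteration alpha delta eta lambda f y0 s -> generated alpha delta eta lambda f y0 s.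
Proof.
  intros Ha Hl He Hgap [H0 HS]. split; [now split|].
  intros s' [H0' HS'] n. induction n as [|n IH]; intros x Hx.
  - now rewrite H0, H0'.
  - now apply (next_iterate_unique alpha delta eta lambda f (s' n) (s n)).
Qed.

(** * Compactness arguments on [0,1] *)

Lemma cont01_bounded g : cont01 g -> exists C, forall x, I01 x -> Rabs (g x) <= C.
Proof.
  intros H.
  assert (H' : cont01 (fun x => Rabs (g x))).
  { intros x. apply (continuous_comp (fun t => g (clamp t)) Rabs); [apply H|].
    apply continuous_Rabs. }
  destruct (continuity_ab_maj (fun t => Rabs (g (clamp t))) 0 1) as (m & M & _); [lra| |].
  - intros c Hc. apply continuity_pt_filterlim, H'.
  - exists (Rabs (g (clamp m))). intros x Hx. generalize (M x Hx). now rewrite (clamp_id x Hx).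
Qed.

(** Dini's theorem, with the absolute value decreasing so that it covers
    increasing and decreasing sequences alike. If the errors at points [x_p]
    stay above [eps], an accumulation point [l] of these points contradicts the
    continuity at [l] of an error that is already below [eps / 2] there. *)
Lemma dini (e : nat -> R -> R) :
  (forall n, cont01 (e n)) ->
  (forall n x, I01 x -> Rabs (e (S n) x) <= Rabs (e n x)) ->
  (forall x, I01 x -> is_lim_seq (fun n => e n x) 0) ->
  unif_cv_01 e (fun _ => 0).
Proof.
  intros C M L eps Heps. apply NNPP. intros N.
  assert (M' : forall x, I01 x -> forall n m, (n <= m)%nat -> Rabs (e m x) <= Rabs (e n x)).
  { intros x Hx n m Hnm. induction Hnm; [lra|].
    eapply Rle_trans; [apply M, Hx|exact IHHnm]. }
  assert (B : forall n, exists x, I01 x /\ eps <= Rabs (e n x)).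
  { intros n. apply NNPP. intros Nn. apply N. exists n. intros m Hm x Hx.
    rewrite Rminus_0_r. apply Rle_lt_trans with (1 := M' x Hx n m Hm).
    apply Rnot_le_lt. intros h. apply Nn. now exists x. }
  apply functional_choice in B as [x B].
  destruct (Bolzano_Weierstrass x I01 (compact_P3 0 1) (fun n => proj1 (B n))) as [l V].
  assert (Ll := L (clamp l) (clamp_I01 l)). apply is_lim_seq_spec in Ll.
  destruct (Ll (mkposreal _ (Rlt_mult_inv_pos _ _ Heps Rlt_0_2))) as [n Hn].
  specialize (Hn n (le_n n)). simpl in Hn. rewrite Rminus_0_r in Hn.
  destruct (proj1 (filterlim_locally _ _) (C n l)
    (mkposreal _ (Rlt_mult_inv_pos _ _ Heps Rlt_0_2))) as [d D].
  destruct (V (disc l d) n) as (p & Hp & Hd).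
  { exists d. intros t Ht. exact Ht. }
  destruct (B p) as [Ip Bp]. specialize (D (x p) Hd).
  change (Rabs (e n (clamp (x p)) - e n (clamp l)) < eps / 2) in D.
  rewrite (clamp_id (x p) Ip) in D.
  generalize (M' (x p) Ip n p Hp). intros Q.
  generalize (Rabs_triang (e n (x p) - e n (clamp l)) (e n (clamp l))).
  replace (e n (x p) - e n (clamp l) + e n (clamp l)) with (e n (x p)) by ring.
  change (Rabs (e n (clamp l)) < eps / 2) in Hn. lra.
Qed.

(** The flux satisfies [|x^alpha y'| <= C x^(alpha+1) / (alpha+1)], hence
    [|y'| <= C x / (alpha+1) <= C]. *)
Lemma jet_lipschitz alpha y y1 y2 C : 1 <= alpha -> jet y y1 y2 -> 0 <= C ->
  (forall x, 0 < x < 1 -> Rabs (radial_op alpha y1 y2 x) <= C) ->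
  forall s t, I01 s -> I01 t -> Rabs (y s - y t) <= C * Rabs (s - t).
Proof.
  intros Ha J HC HL.
  assert (S : forall sg x, sg = 1 \/ sg = -1 -> 0 < x < 1 -> sg * y1 x <= C).
  { intros sg x Hsg Hx.
    assert (Q : sg * (weight alpha x * y1 x) - C / (alpha + 1) * (x * weight alpha x)
      <= sg * (weight alpha 0 * y1 0) - C / (alpha + 1) * (0 * weight alpha 0)).
    { apply (noninc01 (fun x => sg * (weight alpha x * y1 x) - C / (alpha + 1) * (x * weight alpha x))
        (fun x => weight alpha x * (sg * radial_op alpha y1 y2 x - C))); try lra.
      - apply cont01_minus; apply cont01_scal.
        + now apply cont01_flux with y y2.
        + apply cont01_mult; [|now apply cont01_weight].
          apply cont01_of_continuous. intros t _. apply continuous_id.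
      - intros t Ht. evar_last.
        + apply (is_derive_minus (fun x => sg * (weight alpha x * y1 x))
            (fun x => C / (alpha + 1) * (x * weight alpha x))).
          * apply is_derive_scal. apply (jet_flux_derive alpha y y1 y2 t J). lra.
          * apply is_derive_scal, is_derive_id_weight; lra.
        + unfold minus, plus, opp; simpl. field. lra.
      - intros t Ht. generalize (HL t ltac:(lra)) (weight_pos alpha t ltac:(lra)).
        intros A W. apply Rabs_le_between in A.
        assert (sg * radial_op alpha y1 y2 t - C <= 0) by (destruct Hsg as [-> | ->]; lra).
        nra. }
    rewrite weight_0 in Q. generalize (weight_pos alpha x ltac:(lra)). intros W.
    assert (C / (alpha + 1) * x <= C).
    { apply Rmult_le_reg_r with (alpha + 1); [lra|].
      replace (C / (alpha + 1) * x * (alpha + 1)) with (C * x) by (field; lra). nra. }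
    assert (sg * y1 x <= C / (alpha + 1) * x); [|lra].
    apply Rmult_le_reg_r with (1 := W). lra. }
  assert (M : forall sg a b, sg = 1 \/ sg = -1 -> 0 <= a <= b -> b <= 1 ->
    sg * y b - C * b <= sg * y a - C * a).
  { intros sg a b Hsg Hab Hb.
    apply (noninc01 (fun x => sg * y x - C * x) (fun x => sg * y1 x - C)); auto.
    - apply cont01_minus; apply cont01_scal; [apply (jet_cont _ _ _ J)|].
      apply cont01_of_continuous. intros t _. apply continuous_id.
    - intros x Hx. evar_last.
      + apply (is_derive_minus (fun x => sg * y x) (fun x => C * x)).
        * apply is_derive_scal. apply (jet_derive _ _ _ x J). lra.
        * apply is_derive_scal, @is_derive_id.
      + unfold minus, plus, opp, one; simpl. ring.
    - intros x Hx. generalize (S sg x Hsg ltac:(lra)). lra. }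
  assert (K : forall s t, I01 s -> I01 t -> s <= t -> Rabs (y s - y t) <= C * Rabs (s - t)).
  { unfold I01. intros s t Hs Ht Hst.
    generalize (M 1 s t (or_introl eq_refl) ltac:(lra) ltac:(lra))
               (M (-1) s t (or_intror eq_refl) ltac:(lra) ltac:(lra)). intros.
    rewrite (Rabs_minus_sym s t), (Rabs_pos_eq (t - s)) by lra. apply Rabs_le. lra. }
  intros s t Hs Ht. destruct (Rle_dec s t) as [h|h]; [now apply K|].
  rewrite (Rabs_minus_sym (y s)), (Rabs_minus_sym s). apply K; auto. lra.
Qed.

Lemma lipschitz_cont01 g C :
  (forall s t, I01 s -> I01 t -> Rabs (g s - g t) <= C * Rabs (s - t)) -> cont01 g.
Proof.
  intros H x. apply filterlim_locally. intros eps.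
  assert (HC : 0 < Rabs C + 1) by (generalize (Rabs_pos C); lra).
  assert (Hd : 0 < eps / (Rabs C + 1)) by (apply Rdiv_lt_0_compat; [apply cond_pos|lra]).
  exists (mkposreal _ Hd). intros t Ht. change (Rabs (t - x) < eps / (Rabs C + 1)) in Ht.
  change (Rabs (g (clamp t) - g (clamp x)) < eps).
  eapply Rle_lt_trans; [apply H; apply clamp_I01|].
  generalize (clamp_dist t x) (Rabs_pos (clamp t - clamp x)) (Rle_abs C). intros.
  apply Rle_lt_trans with ((Rabs C + 1) * Rabs (t - x)); [nra|].
  replace (pos eps) with ((Rabs C + 1) * (eps / (Rabs C + 1))) by (field; lra).
  now apply Rmult_lt_compat_l.
Qed.

(** * The monotone iteration *)

Section Scheme.
Variables (alpha delta eta lambda : R) (f : R -> R -> R) (u0 v0 : R -> R).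
Hypothesis Ha : 1 <= alpha.
Hypothesis Hl : 0 < lambda.
Hypothesis Hd : 0 < delta.
Hypothesis He : 0 < eta < 1.
Hypothesis Hpos : forall x, I01 x -> 0 < regular alpha lambda x.
Hypothesis Hgap : delta * regular alpha lambda eta < regular alpha lambda 1.
Hypothesis Hvu : forall x, I01 x -> v0 x <= u0 x.
Hypothesis Hu0 : upper_solution alpha delta eta f u0.
Hypothesis Hv0 : lower_solution alpha delta eta f v0.
Hypothesis Hf : continuous_on (region v0 u0) (fun p : R * R => f (fst p) (snd p)).
Hypothesis Hmono : forall x y w, region v0 u0 (x, y) -> region v0 u0 (x, w) -> y <= w ->
  lambda * (w - y) <= f x w - f x y.

Notation next := (next_iterate alpha delta eta lambda f).

Lemma cont01_superposition y : cont01 y -> in_region v0 u0 y -> cont01 (fun x => f x (y x)).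
Proof.
  intros Cy Hy x. apply filterlim_locally. intros eps.
  destruct (proj1 (filterlim_locally _ _) (Hf (clamp x, y (clamp x)) (Hy _ (clamp_I01 x))) eps)
    as [d D].
  destruct (proj1 (filterlim_locally _ _) (Cy x) d) as [d' D'].
  assert (Hm : 0 < Rmin d d') by (apply Rmin_glb_lt; apply cond_pos).
  exists (mkposreal _ Hm). intros t Ht. change (Rabs (t - x) < Rmin d d') in Ht.
  apply (D (clamp t, y (clamp t))).
  - split; simpl.
    + change (Rabs (clamp t - clamp x) < d).
      generalize (clamp_dist t x) (Rmin_l d d'). lra.
    + apply D'. change (Rabs (t - x) < d'). generalize (Rmin_r d d'). lra.
  - apply Hy, clamp_I01.
Qed.

Lemma superposition_lim (s : nat -> R) x l : (forall n, region v0 u0 (x, s n)) ->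
  region v0 u0 (x, l) -> is_lim_seq s l -> is_lim_seq (fun n => f x (s n)) (f x l).
Proof.
  intros Hs Hl' L. apply is_lim_seq_spec. intros eps.
  destruct (proj1 (filterlim_locally _ _) (Hf (x, l) Hl') eps) as [d D].
  apply is_lim_seq_spec in L. destruct (L d) as [N HN].
  exists N. intros n Hn. apply (D (x, s n)); [|apply Hs].
  split; simpl; [apply ball_center|]. apply HN, Hn.
Qed.

Lemma comparison y y1 y2 w w1 w2 :
  jet y y1 y2 -> jet w w1 w2 ->
  y 1 <= delta * y eta -> w 1 >= delta * w eta ->
  (forall x, 0 < x < 1 ->
     radial_op alpha w1 w2 x + lambda * w x <= radial_op alpha y1 y2 x + lambda * y x) ->
  forall x, I01 x -> y x <= w x.
Proof.
  intros Jy Jw By Bw HL x Hx.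
  enough (0 <= 1 * w x + -1 * y x) by lra.
  apply (maximum_principle alpha lambda delta eta _ _ _ Ha Hl Hd He Hpos Hgap
    (jet_lin 1 (-1) _ _ _ _ _ _ Jw Jy)); [| |exact Hx].
  - intros t Ht. generalize (HL t Ht). unfold radial_op. lra.
  - lra.
Qed.

(** The right-hand side [f x y - lambda * y] is nondecreasing in [y]. *)
Lemma next_mono y w yn wn : in_region v0 u0 y -> in_region v0 u0 w ->
  (forall x, I01 x -> y x <= w x) -> next y yn -> next w wn ->
  forall x, I01 x -> yn x <= wn x.
Proof.
  intros Ry Rw Hyw Ny Nw.
  apply next_iterate_jet in Ny as (y1 & y2 & Jy & _ & By & Ey).
  apply next_iterate_jet in Nw as (w1 & w2 & Jw & _ & Bw & Ew).
  apply (comparison yn y1 y2 wn w1 w2); auto; try lra.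
  intros x Hx. assert (Ix : I01 x) by (unfold I01; lra).
  rewrite (Ey x Hx), (Ew x Hx).
  generalize (Hmono x (y x) (w x) (Ry x Ix) (Rw x Ix) (Hyw x Ix)). lra.
Qed.

Lemma next_upper yn : next u0 yn -> forall x, I01 x -> yn x <= u0 x.
Proof.
  intros N. apply next_iterate_jet in N as (y1 & y2 & Jy & _ & By & Ey).
  destruct (upper_solution_jet _ _ _ _ _ Hu0) as (u1 & u2 & Ju & _ & Bu & Eu).
  apply (comparison yn y1 y2 u0 u1 u2); auto; try lra.
  intros x Hx. rewrite (Ey x Hx). generalize (Eu x Hx). lra.
Qed.

Lemma next_lower yn : next v0 yn -> forall x, I01 x -> v0 x <= yn x.
Proof.
  intros N. apply next_iterate_jet in N as (y1 & y2 & Jy & _ & By & Ey).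
  destruct (lower_solution_jet _ _ _ _ _ Hv0) as (v1 & v2 & Jv & _ & Bv & Ev).
  apply (comparison v0 v1 v2 yn y1 y2); auto; try lra.
  intros x Hx. rewrite (Ey x Hx). generalize (Ev x Hx). lra.
Qed.

Lemma in_region_u0 : in_region v0 u0 u0.
Proof. intros x Hx. split; [exact Hx|]. generalize (Hvu x Hx). simpl. lra. Qed.

Lemma in_region_v0 : in_region v0 u0 v0.
Proof. intros x Hx. split; [exact Hx|]. generalize (Hvu x Hx). simpl. lra. Qed.

Lemma cont01_u0 : cont01 u0.
Proof. destruct (upper_solution_jet _ _ _ _ _ Hu0) as (u1 & u2 & Ju & _). apply (jet_cont _ _ _ Ju). Qed.

Lemma cont01_v0 : cont01 v0.
Proof. destruct (lower_solution_jet _ _ _ _ _ Hv0) as (u1 & u2 & Ju & _). apply (jet_cont _ _ _ Ju). Qed.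

Lemma next_exists y : cont01 y -> in_region v0 u0 y -> exists yn, next y yn.
Proof.
  intros Cy Ry.
  destruct (linear_bvp_solvable alpha lambda delta eta (fun x => f x (y x) - lambda * y x)
    Ha Hl He Hpos Hgap) as (z & z1 & z2 & J & Z & B & E).
  - apply cont01_minus; [now apply cont01_superposition|now apply cont01_scal].
  - exists z. apply next_iterate_jet. now exists z1, z2.
Qed.

Lemma next_cont01 y yn : next y yn -> cont01 yn.
Proof. intros (( y1 & y2 & J) & _). apply (jet_cont _ _ _ J). Qed.

(** By monotonicity an iterate lies between the successors of [v0] and [u0],
    which lie between [v0] and [u0]. *)
Lemma next_in_region y yn : in_region v0 u0 y -> next y yn -> in_region v0 u0 yn.
Proof.
  intros Ry N x Hx. split; [exact Hx|]. simpl.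
  destruct (next_exists u0 cont01_u0 in_region_u0) as [a Na].
  destruct (next_exists v0 cont01_v0 in_region_v0) as [b Nb].
  generalize (next_mono y u0 yn a Ry in_region_u0 ltac:(apply Ry) N Na x Hx)
    (next_mono v0 y b yn in_region_v0 Ry ltac:(apply Ry) Nb N x Hx)
    (next_upper a Na x Hx) (next_lower b Nb x Hx). lra.
Qed.

Lemma iteration_exists y0 : cont01 y0 -> in_region v0 u0 y0 ->
  exists s, iteration alpha delta eta lambda f y0 s /\ forall n, in_region v0 u0 (s n).
Proof.
  intros C0 R0.
  (* A successor is chosen once for every function, so that the sequence can be
     defined by plain iteration. *)
  assert (T : forall y, exists yn, cont01 y /\ in_region v0 u0 y -> next y yn).
  { intros y. destruct (classic (cont01 y /\ in_region v0 u0 y)) as [[C R]|n].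
    - destruct (next_exists y C R) as [yn H]. now exists yn.
    - exists y. tauto. }
  apply functional_choice in T as [T HT].
  set (s := fun n => Nat.iter n T y0).
  assert (P : forall n, cont01 (s n) /\ in_region v0 u0 (s n)).
  { induction n as [|n IH]; [now split|]. assert (N := HT _ IH).
    split; [now apply next_cont01 with (s n)|apply (next_in_region (s n)); tauto]. }
  exists s. split; [split|].
  - reflexivity.
  - intros n. apply HT, P.
  - apply P.
Qed.

Lemma iterates_cont01 y0 s : cont01 y0 -> iteration alpha delta eta lambda f y0 s ->
  forall n, cont01 (s n).
Proof.
  intros C0 [E N] [|n].
  - apply cont01_ext with (2 := C0). intros x Hx. symmetry. now apply E.
  - now apply next_cont01 with (s n).
Qed.

(** In [L y_{n+1} = lambda * (y_n - y_{n+1}) - f x y_n] the iterates lie between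
    [v0] and [u0], and [f x y_n] lies between [f x (v0 x)] and [f x (u0 x)]. *)
Lemma iterates_equilipschitz y0 s : iteration alpha delta eta lambda f y0 s ->
  (forall n, in_region v0 u0 (s n)) ->
  exists C, forall n a b, I01 a -> I01 b -> Rabs (s (S n) a - s (S n) b) <= C * Rabs (a - b).
Proof.
  intros [_ N] Rs.
  destruct (cont01_bounded _ cont01_u0) as [Cu Bu].
  destruct (cont01_bounded _ cont01_v0) as [Cv Bv].
  destruct (cont01_bounded _ (cont01_superposition _ cont01_u0 in_region_u0)) as [Du Eu].
  destruct (cont01_bounded _ (cont01_superposition _ cont01_v0 in_region_v0)) as [Dv Ev].
  assert (I0 : I01 0) by (unfold I01; lra).
  assert (P : 0 <= Cu /\ 0 <= Cv /\ 0 <= Du /\ 0 <= Dv).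
  { generalize (Bu 0 I0) (Bv 0 I0) (Eu 0 I0) (Ev 0 I0)
      (Rabs_pos (u0 0)) (Rabs_pos (v0 0)) (Rabs_pos (f 0 (u0 0))) (Rabs_pos (f 0 (v0 0))). lra. }
  exists (lambda * (Cu + Cv) + Du + Dv). intros n.
  destruct (proj1 (next_iterate_jet _ _ _ _ _ _ _) (N n)) as (y1 & y2 & J & _ & _ & E).
  apply (jet_lipschitz alpha _ y1 y2 _ Ha J).
  - assert (0 <= lambda * (Cu + Cv)) by (apply Rmult_le_pos; lra). lra.
  - intros x Hx. assert (Ix : I01 x) by (unfold I01; lra).
    generalize (E x Hx) (Rs n x Ix) (Rs (S n) x Ix). intros Ex R R'.
    assert (V := in_region_v0 x Ix). assert (U := in_region_u0 x Ix).
    destruct (proj2 R) as [R1 R2]. destruct (proj2 R') as [R1' R2']. simpl in R1, R2, R1', R2'.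
    generalize (Hmono x _ _ V R R1) (Hmono x _ _ R U R2). intros M1 M2.
    assert (0 <= lambda * (s n x - v0 x)) by (apply Rmult_le_pos; lra).
    assert (0 <= lambda * (u0 x - s n x)) by (apply Rmult_le_pos; lra).
    generalize (Bu x Ix) (Bv x Ix) (Eu x Ix) (Ev x Ix). intros b1 b2 b3 b4.
    apply Rabs_le_between in b1, b2, b3, b4.
    assert (D : - (Cu + Cv) <= s n x - s (S n) x <= Cu + Cv) by lra.
    assert (- (lambda * (Cu + Cv)) <= lambda * (s n x - s (S n) x) <= lambda * (Cu + Cv)) by nra.
    apply Rabs_le. lra.
Qed.

(** The last hypothesis says that every iterate lies between its predecessor and
    the limit; it covers the increasing and the decreasing sequence, and makes
    the errors of the iterates and of the right-hand sides decrease in absolute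
    value. *)
Lemma iteration_converges y0 s (u : R -> R) : cont01 y0 -> iteration alpha delta eta lambda f y0 s ->
  (forall n, in_region v0 u0 (s n)) ->
  (forall x, I01 x -> is_lim_seq (fun n => s n x) (u x)) ->
  (forall n x, I01 x -> u x <= s (S n) x <= s n x \/ s n x <= s (S n) x <= u x) ->
  unif_cv_01 s u /\ bvp_solution alpha delta eta f u /\ in_region v0 u0 u.
Proof.
  intros C0 Hit Rs L Bt.
  assert (Cs := iterates_cont01 y0 s C0 Hit).
  assert (Ru : in_region v0 u0 u).
  { intros x Hx. split; [exact Hx|]. simpl. split.
    - apply (is_lim_seq_le (fun _ => v0 x) (fun n => s n x) (v0 x) (u x));
        auto using is_lim_seq_const. intros n. apply (Rs n x Hx).
    - apply (is_lim_seq_le (fun n => s n x) (fun _ => u0 x) (u x) (u0 x));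
        auto using is_lim_seq_const. intros n. apply (Rs n x Hx). }
  assert (Cu : cont01 u).
  { destruct (iterates_equilipschitz y0 s Hit Rs) as [K HK].
    apply (lipschitz_cont01 u K). intros a b Ia Ib.
    apply (is_lim_seq_le (fun n => Rabs (s (S n) a - s (S n) b)) (fun _ => K * Rabs (a - b))
      (Rabs (u a - u b)) (K * Rabs (a - b))); auto using is_lim_seq_const.
    apply (is_lim_seq_abs (fun n => s (S n) a - s (S n) b) (u a - u b)).
    apply (is_lim_seq_incr_1 (fun n => s n a - s n b)).
    apply is_lim_seq_minus'; now apply L. }
  assert (Unif : unif_cv_01 s u).
  { assert (D : unif_cv_01 (fun n x => s n x - u x) (fun _ => 0)).
    { apply dini.
      - intros n. now apply cont01_minus.
      - intros n x Hx. destruct (Bt n x Hx).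
        + rewrite !Rabs_pos_eq; lra.
        + rewrite (Rabs_minus_sym (s (S n) x)), (Rabs_minus_sym (s n x)), !Rabs_pos_eq; lra.
      - intros x Hx. replace 0 with (u x - u x) by ring.
        apply is_lim_seq_minus'; [now apply L|apply is_lim_seq_const]. }
    intros eps Heps. destruct (D eps Heps) as [N HN]. exists N. intros n Hn x Hx.
    generalize (HN n Hn x Hx). now rewrite Rminus_0_r. }
  split; [exact Unif|]. split; [|exact Ru].
  set (g := fun y x => f x (y x) - lambda * y x).
  assert (Cg : forall y, cont01 y -> in_region v0 u0 y -> cont01 (g y)).
  { intros y Cy Ry. apply cont01_minus; [now apply cont01_superposition|now apply cont01_scal]. }
  assert (UnifG : unif_cv_01 (fun n x => g (s n) x - g u x) (fun _ => 0)).
  { apply dini.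
    - intros n. apply cont01_minus; auto.
    - intros n x Hx. unfold g.
      generalize (Rs n x Hx) (Rs (S n) x Hx) (Ru x Hx). intros R R' R''.
      destruct (Bt n x Hx) as [[b1 b2]|[b1 b2]].
      + generalize (Hmono x _ _ R'' R' b1) (Hmono x _ _ R' R b2). intros.
        rewrite !Rabs_pos_eq; lra.
      + generalize (Hmono x _ _ R' R'' b2) (Hmono x _ _ R R' b1). intros.
        rewrite (Rabs_minus_sym _ (f x (u x) - lambda * u x)),
          (Rabs_minus_sym (f x (s n x) - lambda * s n x)), !Rabs_pos_eq; lra.
    - intros x Hx. replace 0 with (g u x - g u x) by ring.
      apply is_lim_seq_minus'; [|apply is_lim_seq_const]. unfold g.
      apply is_lim_seq_minus'.
      + apply superposition_lim; auto. intros n. now apply Rs.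
      + apply (is_lim_seq_scal_l (fun n => s n x) lambda (u x)). now apply L. }
  destruct (linear_bvp_solvable alpha lambda delta eta (g u) Ha Hl He Hpos Hgap)
    as (U & U1 & U2 & JU & ZU & BU & EU); [now apply Cg|].
  destruct (linear_bvp_solvable alpha lambda delta eta (fun _ => 1) Ha Hl He Hpos Hgap)
    as (P & P1 & P2 & JP & ZP & BP & EP); [apply cont01_const|].
  assert (Close : forall eps x, 0 < eps -> I01 x -> Rabs (u x - U x) <= eps * P x).
  { intros eps x Heps Hx. destruct (UnifG eps Heps) as [N HN].
    apply (is_lim_seq_le (fun n => Rabs (s (S (n + N)) x - U x)) (fun _ => eps * P x)
      (Rabs (u x - U x)) (eps * P x)).
    - intros n. destruct Hit as [_ Hit].
      destruct (proj1 (next_iterate_jet _ _ _ _ _ _ _) (Hit (n + N)%nat))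
        as (y1 & y2 & J & _ & By & E).
      (* The difference solves the linear problem with a right-hand side of absolute
         value below [eps], and [eps * P] the one with right-hand side [eps]. *)
      assert (Q : forall sg, sg = 1 \/ sg = -1 -> sg * (s (S (n + N)) x - U x) <= eps * P x).
      { intros sg Hsg.
        assert (A : 1 * (sg * s (S (n + N)) x + - sg * U x) + 0 * P x <= eps * P x + 0 * U x).
        { apply (comparison _ _ _ _ _ _
            (jet_lin 1 0 _ _ _ _ _ _ (jet_lin sg (- sg) _ _ _ _ _ _ J JU) JP)
            (jet_lin eps 0 _ _ _ _ _ _ JP JU)); [| | |exact Hx].
          - rewrite By, BU. lra.
          - rewrite BP, BU. lra.
          - intros t Ht. generalize (E t Ht) (EU t Ht) (EP t Ht).
            generalize (HN (n + N)%nat ltac:(lia) t ltac:(unfold I01; lra)).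
            rewrite Rminus_0_r. unfold g at 1 2. intros A.
            change (f t (u t) - lambda * u t) with (g u t) in A.
            change (f t (s (n + N)%nat t) - lambda * s (n + N)%nat t) with (g (s (n + N)%nat) t).
            change (f t (s (n + N)%nat t) - lambda * s (n + N)%nat t) with (g (s (n + N)%nat) t) in A.
            apply Rabs_def2 in A. unfold radial_op. intros E1 E2 E3.
            assert (B1 : eps * (P2 t + alpha / t * P1 t + lambda * P t) = - eps) by (rewrite E3; ring).
            destruct Hsg as [-> | ->]; lra. }
        lra. }
      generalize (Q 1 (or_introl eq_refl)) (Q (-1) (or_intror eq_refl)). intros.
      apply Rabs_le. lra.
    - apply (is_lim_seq_abs (fun n => s (S (n + N)) x - U x) (u x - U x)).
      apply is_lim_seq_minus'; [|apply is_lim_seq_const].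
      apply (is_lim_seq_incr_1 (fun n => s (n + N)%nat x)).
      apply (is_lim_seq_incr_n (fun n => s n x) N). now apply L.
    - apply is_lim_seq_const. }
  assert (EuU : forall x, I01 x -> U x = u x).
  { intros x Hx. symmetry. apply Rminus_diag_uniq, Rabs_eq_0.
    apply Rle_antisym; [|apply Rabs_pos]. apply le_epsilon. intros eps Heps.
    assert (HP : 0 < Rabs (P x) + 1) by (generalize (Rabs_pos (P x)); lra).
    assert (Heps' : 0 < eps / (Rabs (P x) + 1)) by now apply Rdiv_lt_0_compat.
    generalize (Close _ x Heps' Hx) (Rle_abs (P x)). intros.
    rewrite Rplus_0_l.
    replace eps with (eps / (Rabs (P x) + 1) * (Rabs (P x) + 1)) by (field; lra). nra. }
  apply bvp_solution_fixpoint with lambda. apply next_iterate_jet.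
  exists U1, U2. split; [now apply jet_ext with U|]. split; [exact ZU|].
  rewrite <- !EuU by (unfold I01; lra). split; [exact BU|].
  intros x Hx. rewrite <- (EuU x) at 1 by (unfold I01; lra). now apply EU.
Qed.

Lemma upper_scheme : exists un u,
  (generated alpha delta eta lambda f u0 un /\
   (forall n, in_region v0 u0 (un n)) /\
   (forall n x, I01 x -> un (S n) x <= un n x) /\
   unif_cv_01 un u /\
   bvp_solution alpha delta eta f u /\ in_region v0 u0 u) /\
  (forall z, bvp_solution alpha delta eta f z -> in_region v0 u0 z ->
     forall x, I01 x -> z x <= u x).
Proof.
  destruct (iteration_exists u0 cont01_u0 in_region_u0) as (s & Hit & Rs).
  destruct (Hit) as [E0 N].
  assert (M : forall n x, I01 x -> s (S n) x <= s n x).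
  { induction n as [|n IH]; intros x Hx.
    - rewrite (E0 x Hx). apply next_upper; [|exact Hx].
      now apply next_iterate_ext with (s O).
    - now apply (next_mono (s (S n)) (s n)). }
  set (u := fun x => real (Lim_seq (fun n => s n x))).
  assert (L : forall x, I01 x -> is_lim_seq (fun n => s n x) (u x)).
  { intros x Hx. apply Lim_seq_correct'.
    apply ex_finite_lim_seq_decr with (v0 x); [intros n; now apply M|].
    intros n. apply (Rs n x Hx). }
  assert (D : forall n x, I01 x -> u x <= s n x).
  { intros n x Hx. apply (is_lim_seq_decr_compare (fun n => s n x)); [now apply L|].
    intros m. now apply M. }
  exists s, u. split; [split|].
  - now apply iteration_generated.
  - split; [exact Rs|]. split; [exact M|].
    apply (iteration_converges u0 s u); auto using cont01_u0.
  - intros z Hz Rz x Hx.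
    assert (Z : forall n x, I01 x -> z x <= s n x).
    { induction n as [|n IH]; intros t Ht.
      - rewrite (E0 t Ht). apply (Rz t Ht).
      - apply (next_mono z (s n)); auto. now apply bvp_solution_fixpoint. }
    apply (is_lim_seq_le (fun _ => z x) (fun n => s n x) (z x) (u x));
      auto using is_lim_seq_const.
Qed.

Lemma lower_scheme : exists vn v,
  (generated alpha delta eta lambda f v0 vn /\
   (forall n, in_region v0 u0 (vn n)) /\
   (forall n x, I01 x -> vn n x <= vn (S n) x) /\
   unif_cv_01 vn v /\
   bvp_solution alpha delta eta f v /\ in_region v0 u0 v) /\
  (forall z, bvp_solution alpha delta eta f z -> in_region v0 u0 z ->
     forall x, I01 x -> v x <= z x).
Proof.
  destruct (iteration_exists v0 cont01_v0 in_region_v0) as (s & Hit & Rs).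
  destruct (Hit) as [E0 N].
  assert (M : forall n x, I01 x -> s n x <= s (S n) x).
  { induction n as [|n IH]; intros x Hx.
    - rewrite (E0 x Hx). apply next_lower; [|exact Hx].
      now apply next_iterate_ext with (s O).
    - now apply (next_mono (s n) (s (S n))). }
  set (v := fun x => real (Lim_seq (fun n => s n x))).
  assert (L : forall x, I01 x -> is_lim_seq (fun n => s n x) (v x)).
  { intros x Hx. apply Lim_seq_correct'.
    apply ex_finite_lim_seq_incr with (u0 x); [intros n; now apply M|].
    intros n. apply (Rs n x Hx). }
  assert (D : forall n x, I01 x -> s n x <= v x).
  { intros n x Hx. apply (is_lim_seq_incr_compare (fun n => s n x)); [now apply L|].
    intros m. now apply M. }
  exists s, v. split; [split|].
  - now apply iteration_generated.
  - split; [exact Rs|]. split; [exact M|].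
    apply (iteration_converges v0 s v); auto using cont01_v0.
  - intros z Hz Rz x Hx.
    assert (Z : forall n x, I01 x -> s n x <= z x).
    { induction n as [|n IH]; intros t Ht.
      - rewrite (E0 t Ht). apply (Rz t Ht).
      - apply (next_mono (s n) z); auto. now apply bvp_solution_fixpoint. }
    apply (is_lim_seq_le (fun n => s n x) (fun _ => z x) (v x) (z x));
      auto using is_lim_seq_const.
Qed.
End Scheme.

(** * Proof of the theorem *)

(** The two opposite differential inequalities and boundary inequalities hold
    for the same function. *)
Lemma bvp_solution_of_coincidence alpha delta eta f u v :
  0 < eta < 1 -> (forall x, I01 x -> v x = u x) ->
  upper_solution alpha delta eta f u -> lower_solution alpha delta eta f v ->
  bvp_solution alpha delta eta f u.
Proof.
  intros He E Hu Hv.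
  destruct (upper_solution_jet _ _ _ _ _ Hu) as (_ & _ & _ & _ & Bu & _).
  destruct (lower_solution_jet _ _ _ _ _ Hv) as (v1 & v2 & Jv & Zv & Bv & Ev).
  assert (J : jet u v1 v2) by now apply jet_ext with v.
  apply bvp_solution_jet. exists v1, v2. split; [exact J|]. split; [exact Zv|].
  rewrite !E in Bv by (unfold I01; lra). split; [lra|].
  intros x Hx. apply Rle_antisym.
  - apply (SL_op_compare alpha u v1 v2 x (f x (u x)) J Hx). now apply Hu.
  - rewrite <- E by (unfold I01; lra). now apply Ev.
Qed.

Theorem theorem5p2 :
  forall (alpha delta eta nu : R) (f : R -> R -> R) (u0 v0 : R -> R)
         (M2 lambda : R),
    1 <= alpha -> 0 < delta -> 0 < eta < 1 -> nu = (1 - alpha) / 2 ->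
    (forall x, I01 x -> v0 x <= u0 x) ->
    upper_solution alpha delta eta f u0 ->
    lower_solution alpha delta eta f v0 ->
    continuous_on (region v0 u0) (fun p : R * R => f (fst p) (snd p)) ->
    0 <= M2 ->
    (forall x y w, region v0 u0 (x, y) -> region v0 u0 (x, w) -> y <= w ->
       f x w - f x y >= M2 * (w - y)) ->
    0 < lambda -> M2 - lambda >= 0 ->
    condition_a alpha delta eta nu lambda \/
    condition_b alpha delta eta nu lambda ->
    (exists y, bvp_solution alpha delta eta f y /\ in_region v0 u0 y) /\
    exists (un vn : nat -> R -> R) (u v : R -> R),
      (generated alpha delta eta lambda f u0 un /\
       (forall n, in_region v0 u0 (un n)) /\
       (forall n x, I01 x -> un (S n) x <= un n x) /\
       unif_cv_01 un u /\
       bvp_solution alpha delta eta f u /\ in_region v0 u0 u) /\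
      (generated alpha delta eta lambda f v0 vn /\
       (forall n, in_region v0 u0 (vn n)) /\
       (forall n x, I01 x -> vn n x <= vn (S n) x) /\
       unif_cv_01 vn v /\
       bvp_solution alpha delta eta f v /\ in_region v0 u0 v) /\
      (forall z, bvp_solution alpha delta eta f z -> in_region v0 u0 z ->
         forall x, I01 x -> v x <= z x <= u x).
Proof.
  intros alpha delta eta nu f u0 v0 M2 lambda Ha Hd He Hnu Hvu Hu0 Hv0 Hf HM2 HM Hl HMl Hcond.
  assert (Hgap : delta * regular alpha lambda eta < regular alpha lambda 1).
  { apply (regular_gap alpha lambda delta eta nu); try lra.
    destruct Hcond as [C|C]; apply C. }
  assert (Hmono : forall x y w, region v0 u0 (x, y) -> region v0 u0 (x, w) -> y <= w ->
    lambda * (w - y) <= f x w - f x y).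
  { intros x y w Hy Hw Hyw. generalize (HM x y w Hy Hw Hyw). nra. }
  destruct (classic (exists a, I01 a /\ v0 a < u0 a)) as [(a & Ia & Hlt)|Heq].
  - assert (Hpos : forall x, I01 x -> 0 < regular alpha lambda x).
    { destruct (upper_solution_jet _ _ _ _ _ Hu0) as (u1 & u2 & Ju & _ & Bu & Eu).
      destruct (lower_solution_jet _ _ _ _ _ Hv0) as (v1 & v2 & Jv & _ & Bv & Ev).
      apply (regular_pos alpha lambda delta eta _ _ _ a Ha Hl Hd He
               (jet_lin 1 (-1) _ _ _ _ _ _ Ju Jv)); auto.
      - intros x Hx. generalize (Hvu x Hx). lra.
      - lra.
      - intros x Hx. assert (Ix : I01 x) by (unfold I01; lra).
        generalize (Hmono x (v0 x) (u0 x) (in_region_v0 u0 v0 Hvu x Ix)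
                      (in_region_u0 u0 v0 Hvu x Ix) (Hvu x Ix)) (Eu x Hx) (Ev x Hx).
        unfold radial_op. lra.
      - lra. }
    destruct (upper_scheme alpha delta eta lambda f u0 v0) as (un & u & U & Umax); auto.
    destruct (lower_scheme alpha delta eta lambda f u0 v0) as (vn & v & V & Vmin); auto.
    split; [exists u; tauto|].
    exists un, vn, u, v. split; [exact U|]. split; [exact V|].
    intros z Hz Rz x Hx. split; [now apply Vmin|now apply Umax].
  - assert (E : forall x, I01 x -> v0 x = u0 x).
    { intros x Hx. apply Rle_antisym; [now apply Hvu|].
      apply Rnot_lt_le. intros h. apply Heq. now exists x. }
    assert (S0 := bvp_solution_of_coincidence _ _ _ _ _ _ He E Hu0 Hv0).
    assert (R0 := in_region_u0 u0 v0 Hvu).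
    assert (G : forall y0, (forall x, I01 x -> u0 x = y0 x) ->
      generated alpha delta eta lambda f y0 (fun _ => u0)).
    { intros y0 E0. apply iteration_generated; auto. split; [exact E0|].
      intros _. now apply bvp_solution_fixpoint. }
    assert (Cv : unif_cv_01 (fun _ => u0) u0).
    { intros eps Heps. exists O. intros n _ x _. unfold Rminus. now rewrite Rplus_opp_r, Rabs_R0. }
    split; [now exists u0|].
    exists (fun _ => u0), (fun _ => u0), u0, u0.
    split; [|split].
    + exact (conj (G u0 (fun x _ => eq_refl)) (conj (fun _ => R0)
        (conj (fun _ x _ => Rle_refl (u0 x)) (conj Cv (conj S0 R0))))).
    + exact (conj (G v0 (fun x Hx => eq_sym (E x Hx))) (conj (fun _ => R0)
        (conj (fun _ x _ => Rle_refl (u0 x)) (conj Cv (conj S0 R0))))).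
    + intros z _ Rz x Hx. destruct (Rz x Hx) as [_ Q]. simpl in Q. rewrite (E x Hx) in Q. exact Q.
Qed.
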